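(* For every proper CAT(0) space $X$ and every $\kappa$ as in the standing assumptions, the topological space $\partial_\kappa X$ (with the topology defined below) is metrizable.
   Context: $X$ proper CAT(0), base point $\mathfrak o$, $\|x\|=d_X(\mathfrak o,x)$. $\kappa:[0,\infty)\to[1,\infty)$ monotone increasing, concave, sublinear; $\kappa(x)=\kappa(\|x\|)$. Quasi-geodesic rays are continuous $(q,Q)$--quasi-isometric embeddings $[0,\infty)\to X$ starting at $\mathfrak o$. $\mathcal N_\kappa(Z,n)=\{x:d_X(x,Z)\le n\kappa(x)\}$. Rays $\kappa$--fellow travel if each lies in some $\mathcal N_\kappa(\cdot,n)$ of the other; classes are denoted $[\beta]$. A closed set $Z$ is $\kappa$--contracting if there is $c_Z$ with $\operatorname{diam}(x_Z\cup y_Z)\le c_Z\kappa(x)$ whenever $d_X(x,y)\le d_X(x,Z)$ ($x_Z$ = nearest points). $\partial_\kappa X$ is the set of $\kappa$--fellow-travelling classes of $\kappa$--contracting quasi-geodesic rays; each class $\mathbf b$ contains a unique geodesic ray $b$, which is $\kappa$--contracting. For each $\mathbf b$ fix a function $m_b:\mathbb R^2\to\mathbb R_+$ with $m_b(q,Q)\ge\max(q,Q)$ satisfying the strongly Morse property for $Z=b$: for all $r,n>0$ and sublinear $\kappa'$ there is $R>0$ such that for every $(q,Q)$--quasi-geodesic ray $\eta$ with $m_b(q,Q)\le r/(2\kappa(r))$, if $d_X(\eta(t_R),b)\le n\kappa'(R)$ then $\eta|_r\subset\mathcal N_\kappa(b,m_b(q,Q))$; here $t_\rho$ is the first time $\|\eta(t_\rho)\|=\rho$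 and $\eta|_\rho=\eta([0,t_\rho])$. For $r>0$, $\mathcal U_\kappa(\mathbf b,r)$ is the set of $\mathbf a\in\partial_\kappa X$ such that every $(q,Q)$--quasi-geodesic ray $\alpha\in\mathbf a$ with $m_b(q,Q)\le r/(2\kappa(r))$ satisfies $\alpha|_r\subset\mathcal N_\kappa(b,m_b(q,Q))$. The topology on $\partial_\kappa X$: $\mathcal W\subset\partial_\kappa X$ is open iff for every $\mathbf b\in\mathcal W$ there is $r>0$ with $\mathcal U_\kappa(\mathbf b,r)\subset\mathcal W$. *)

(* Defs.v *)
From Stdlib Require Import Reals List.
Open Scope R_scope.

Definition is_metric {X : Type} (d : X -> X -> R) : Prop :=
  (forall x y, 0 <= d x y) /\ (forall x y, d x y = 0 <-> x = y) /\
  (forall x y, d x y = d y x) /\ (forall x y z, d x z <= d x y + d y z).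

Definition mopen {X : Type} (d : X -> X -> R) (U : X -> Prop) : Prop :=
  forall x, U x -> exists e, 0 < e /\ forall y, d x y < e -> U y.

Definition mclosed {X : Type} (d : X -> X -> R) (Z : X -> Prop) : Prop :=
  forall (u : nat -> X) (x : X), (forall n, Z (u n)) ->
    (forall eps, 0 < eps -> exists N, forall n, (N <= n)%nat -> d (u n) x < eps) ->
    Z x.

Definition compact {X : Type} (d : X -> X -> R) (K : X -> Prop) : Prop :=
  forall (I : Type) (U : I -> X -> Prop), (forall i, mopen d (U i)) ->
    (forall x, K x -> exists i, U i x) ->
    exists l : list I, forall x, K x -> exists i, In i l /\ U i x.

Definition proper_space {X : Type} (d : X -> X -> R) : Prop :=
  forall x r, compact d (fun y => d x y <= r).

Definition geodesic_segment {X : Type} (d : X -> X -> R) (x y : X) (c : R -> X) : Prop :=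
  c 0 = x /\ c (d x y) = y /\
  forall s t, 0 <= s <= d x y -> 0 <= t <= d x y -> d (c s) (c t) = Rabs (s - t).

Definition geodesic_space {X : Type} (d : X -> X -> R) : Prop :=
  forall x y : X, exists c, geodesic_segment d x y c.

Definition edist (p q : R * R) : R :=
  sqrt ((fst p - fst q) ^ 2 + (snd p - snd q) ^ 2).

Definition eseg (p q : R * R) (L s : R) : R * R :=
  (fst p + s / L * (fst q - fst p), snd p + s / L * (snd q - snd p)).

Definition CAT0 {X : Type} (d : X -> X -> R) : Prop :=
  geodesic_space d /\
  forall (x y z : X) (c1 c2 c3 : R -> X) (xb yb zb : R * R),
    geodesic_segment d x y c1 -> geodesic_segment d y z c2 ->
    geodesic_segment d z x c3 ->
    edist xb yb = d x y -> edist yb zb = d y z -> edist zb xb = d z x ->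
    let side (k : nat) := match k with 0%nat => c1 | 1%nat => c2 | _ => c3 end in
    let cside (k : nat) := match k with
                           | 0%nat => eseg xb yb (d x y)
                           | 1%nat => eseg yb zb (d y z)
                           | _ => eseg zb xb (d z x) end in
    let len (k : nat) := match k with 0%nat => d x y | 1%nat => d y z | _ => d z x end in
    forall (i j : nat) (s t : R), 0 <= s <= len i -> 0 <= t <= len j ->
      d (side i s) (side j t) <= edist (cside i s) (cside j t).

Definition sublinear_fun (k : R -> R) : Prop :=
  (forall t, 0 <= t -> 1 <= k t) /\
  (forall s t, 0 <= s <= t -> k s <= k t) /\
  (forall s t l, 0 <= s -> 0 <= t -> 0 <= l <= 1 ->
     l * k s + (1 - l) * k t <= k (l * s + (1 - l) * t)) /\
  (forall eps, 0 < eps -> exists T, forall t, T <= t -> k t / t <= eps).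

(** d(x,Z) <= r, i.e. inf_{z in Z} d(x,z) <= r *)
Definition dist_le {X : Type} (d : X -> X -> R) (Z : X -> Prop) (x : X) (r : R) : Prop :=
  forall eps, 0 < eps -> exists z, Z z /\ d x z < r + eps.

Definition Nk {X : Type} (d : X -> X -> R) (o : X) (k : R -> R)
  (Z : X -> Prop) (n : R) : X -> Prop :=
  fun x => dist_le d Z x (n * k (d o x)).

Definition img {X : Type} (a : R -> X) : X -> Prop :=
  fun x => exists t, 0 <= t /\ x = a t.

Definition qg_ray {X : Type} (d : X -> X -> R) (o : X) (q Q : R) (a : R -> X) : Prop :=
  1 <= q /\ 0 <= Q /\ a 0 = o /\
  (forall t, 0 <= t -> forall eps, 0 < eps -> exists del, 0 < del /\
     forall s, 0 <= s -> Rabs (s - t) < del -> d (a s) (a t) < eps) /\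
  (forall s t, 0 <= s -> 0 <= t ->
     Rabs (s - t) / q - Q <= d (a s) (a t) <= q * Rabs (s - t) + Q).

Definition geod_ray {X : Type} (d : X -> X -> R) (o : X) (a : R -> X) : Prop :=
  a 0 = o /\ forall s t, 0 <= s -> 0 <= t -> d (a s) (a t) = Rabs (s - t).

Definition nearest {X : Type} (d : X -> X -> R) (Z : X -> Prop) (x z : X) : Prop :=
  Z z /\ forall z', Z z' -> d x z <= d x z'.

Definition contracting {X : Type} (d : X -> X -> R) (o : X) (k : R -> R)
  (Z : X -> Prop) : Prop :=
  mclosed d Z /\
  exists c, forall x y : X, (forall z, Z z -> d x y <= d x z) ->
    forall p p', (nearest d Z x p \/ nearest d Z y p) ->
                 (nearest d Z x p' \/ nearest d Z y p') ->
                 d p p' <= c * k (d o x).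

Definition kray {X : Type} (d : X -> X -> R) (o : X) (k : R -> R) (a : R -> X) : Prop :=
  (exists q Q, qg_ray d o q Q a) /\ contracting d o k (img a).

Definition fellow {X : Type} (d : X -> X -> R) (o : X) (k : R -> R) (a b : R -> X) : Prop :=
  (exists n, forall x, img a x -> Nk d o k (img b) n x) /\
  (exists n, forall x, img b x -> Nk d o k (img a) n x).

Definition is_class {X : Type} (d : X -> X -> R) (o : X) (k : R -> R)
  (A : (R -> X) -> Prop) : Prop :=
  exists b, kray d o k b /\ forall a, A a <-> (kray d o k a /\ fellow d o k a b).

Definition bdry {X : Type} (d : X -> X -> R) (o : X) (k : R -> R) : Type :=
  { A : (R -> X) -> Prop | is_class d o k A }.

Definition first_hit {X : Type} (d : X -> X -> R) (o : X) (a : R -> X) (r t : R) : Prop :=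
  0 <= t /\ d o (a t) = r /\ forall s, 0 <= s < t -> d o (a s) <> r.

Definition restr {X : Type} (d : X -> X -> R) (o : X) (a : R -> X) (r : R) : X -> Prop :=
  fun x => exists tr t, first_hit d o a r tr /\ 0 <= t <= tr /\ x = a t.

Definition strongly_Morse {X : Type} (d : X -> X -> R) (o : X) (k : R -> R)
  (b : R -> X) (m : R -> R -> R) : Prop :=
  forall r n, 0 < r -> 0 < n -> forall k', sublinear_fun k' ->
  exists R0, 0 < R0 /\
    forall q Q eta, qg_ray d o q Q eta -> m q Q <= r / (2 * k r) ->
    forall tR, first_hit d o eta R0 tR ->
      dist_le d (img b) (eta tR) (n * k' R0) ->
      forall x, restr d o eta r x -> Nk d o k (img b) (m q Q) x.

Definition Morse_gauges {X : Type} (d : X -> X -> R) (o : X) (k : R -> R)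
  (M : bdry d o k -> R -> R -> R) : Prop :=
  forall B : bdry d o k,
    (forall q Q, 0 <= M B q Q /\ Rmax q Q <= M B q Q) /\
    (forall b, proj1_sig B b -> geod_ray d o b -> strongly_Morse d o k b (M B)).

(** U_kappa(B, r); b is the geodesic ray in B *)
Definition Uk {X : Type} (d : X -> X -> R) (o : X) (k : R -> R)
  (M : bdry d o k -> R -> R -> R) (B : bdry d o k) (r : R) : bdry d o k -> Prop :=
  fun A => forall b, proj1_sig B b -> geod_ray d o b ->
    forall q Q a, proj1_sig A a -> qg_ray d o q Q a -> M B q Q <= r / (2 * k r) ->
    forall x, restr d o a r x -> Nk d o k (img b) (M B q Q) x.

Definition bd_open {X : Type} (d : X -> X -> R) (o : X) (k : R -> R)
  (M : bdry d o k -> R -> R -> R) (W : bdry d o k -> Prop) : Prop :=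
  forall B, W B -> exists r, 0 < r /\ forall A, Uk d o k M B r A -> W A.

Definition metrizable {T : Type} (opn : (T -> Prop) -> Prop) : Prop :=
  exists D : T -> T -> R, is_metric D /\ forall W, opn W <-> mopen D W.

(* Main.v *)
Require Import Defs.
From Stdlib Require Import Reals List.
From Stdlib Require Import Arith Lra Lia Classical ClassicalEpsilon
  FunctionalExtensionality PropExtensionality ProofIrrelevance.
Open Scope R_scope.

(** Metrizability comes from Frink's criterion: it suffices to give decreasing neighbourhoods
    [U_m(b)] with intersection [{b}] such that for all [b], [n] some [m] satisfies
    [U_m(a)] meets [U_m(b)] implies [U_m(a)] is contained in [U_n(b)].  Take
    [U_m(b) = U_kappa(b, r_m(b))], with [r_m(b)] so large that [(m, m)]-quasi-geodesics of
    members of [U_m(b)] pass, at radius [r_m(b)], much closer to [b] than [r_m(b)].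
    If [c] lies in [U_m(a)] and [U_m(b)], and [d] in [U_m(a)], then a quasi-geodesic [eta] of
    [d] is close to the geodesic of [c] at radius [r_m(a) >= m]; cutting [eta] there and
    continuing along the geodesic of [c] gives a quasi-geodesic of the class [c] with constants
    depending only on those of [eta], so [eta] is close to [b] at any prescribed radius at most
    [m / 2], and the Morse property of [b] applies.  Only [m_b(n, n)] with [n] an integer matters,
    because a [(q, Q)]-quasi-geodesic is an [(n, n)]-quasi-geodesic for [n >= max(q, Q)]. *)

(** * Metrization *)

(** The obstacle is the order of the quantifiers: [m] is chosen from [b] and [n] before [a] is
    known, while the gauge of [a] is arbitrary. Two features of the radii remove the dependence on
    [a]. They absorb the gauge: at radius [r_m(a)] the error of the [(m, m)]-quasi-geodesics in
    question is at most an eighth of the radius, and the surgery tolerates a gap of a quarter of the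
    radius, with constants that do not see [a]. And [r_m(a) >= m] for every [a], so the cut happens
    beyond a radius fixed by [b] and [n] alone. The sets [U_m(b)] are not shown to be open: openness
    asks for some [U_m(b)] around each point, and metric balls are compared with these sets point by
    point. That the new ray belongs to the class of [c] rests on the transfer of contraction between
    fellow-travelling rays. *)

Inductive chain {T : Type} (E : nat -> T -> T -> Prop) : nat -> T -> T -> R -> Prop :=
| chain_nil x : chain E 0 x x 0
| chain_cons n k x y z s :
    E k x y -> chain E n y z s -> chain E (S n) x z ((1/2) ^ k + s).

Lemma half_pow_pos k : 0 < (1/2) ^ k.
Proof. apply pow_lt; lra. Qed.

Lemma half_pow_lt_inv j k : (1/2) ^ k < (1/2) ^ j -> (j < k)%nat.
Proof.
  intros H. destruct (le_lt_dec k j) as [Hkj|Hkj]; [|lia]. exfalso.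
  replace j with (k + (j - k))%nat in H by lia.
  rewrite pow_add in H.
  assert (H1 : (1/2) ^ (j - k) <= 1).
  { apply Rle_trans with (1 ^ (j - k)); [apply pow_incr; lra|rewrite pow1; lra]. }
  pose proof (half_pow_pos k). nra.
Qed.

Lemma half_pow_arch e : 0 < e -> exists k, (1/2) ^ k < e.
Proof.
  intros He. destruct (pow_lt_1_zero (1/2)) with (y := e) as [N HN]; auto.
  - rewrite Rabs_right; lra.
  - exists N. specialize (HN N (le_n N)).
    rewrite Rabs_right in HN; auto. left; apply half_pow_pos.
Qed.

Lemma inf_exists (P : R -> Prop) :
  (exists s, P s) -> (forall s, P s -> 0 <= s) ->
  exists m, (forall s, P s -> m <= s) /\ forall e, 0 < e -> exists s, P s /\ s < m + e.
Proof.
  intros [s0 H0] Hpos.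
  destruct (completeness (fun x => P (- x))) as [m [Hub Hlub]].
  - exists 0. intros x Hx. apply Hpos in Hx. lra.
  - exists (- s0). now rewrite Ropp_involutive.
  - exists (- m). split.
    + intros s Hs. assert (- s <= m); [|lra]. apply Hub. now rewrite Ropp_involutive.
    + intros e He. apply NNPP. intros Hn.
      assert (m <= m - e); [|lra]. apply Hlub. intros x Hx.
      destruct (Rle_lt_dec x (m - e)) as [|Hlt]; auto.
      exfalso. apply Hn. exists (- x). split; auto. lra.
Qed.

Section ChainMetric.
Context {T : Type} (E : nat -> T -> T -> Prop).

Lemma chain_ge0 n x y s : chain E n x y s -> 0 <= s.
Proof.
  induction 1; [lra|]. pose proof (half_pow_pos k). lra.
Qed.

Lemma chain_app n1 x y s1 : chain E n1 x y s1 ->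
  forall n2 z s2, chain E n2 y z s2 -> exists n, chain E n x z (s1 + s2).
Proof.
  induction 1 as [x|n k x y w s1 HE _ IH]; intros n2 z s2 H2.
  - exists n2. now rewrite Rplus_0_l.
  - destruct (IH _ _ _ H2) as [m Hm]. exists (S m).
    rewrite Rplus_assoc. econstructor; eauto.
Qed.

Lemma chain_one k x y : E k x y -> chain E 1 x y ((1/2) ^ k).
Proof.
  intros H. replace ((1/2) ^ k) with ((1/2) ^ k + 0) by ring.
  econstructor; eauto. constructor.
Qed.

Lemma chain_rev (Esym : forall k x y, E k x y -> E k y x) n x y s :
  chain E n x y s -> exists m, chain E m y x s.
Proof.
  induction 1 as [x|n k x y w s HE _ [m Hm]].
  - exists 0%nat. constructor.
  - rewrite Rplus_comm. eapply chain_app; eauto. apply chain_one; auto.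
Qed.

(** Follow the chain until the running cost exceeds [h]. Both remaining pieces have fewer edges,
    which feeds the strong induction in [chain_small]. *)
Lemma chain_split n x z s : chain E n x z s -> forall h, 0 <= h ->
  s <= h \/
  exists n1 n2 k u v s1 s2,
    chain E n1 x u s1 /\ E k u v /\ chain E n2 v z s2 /\ (n1 < n)%nat /\ (n2 < n)%nat /\
    s1 <= h /\ h < s1 + (1/2) ^ k /\ s = s1 + (1/2) ^ k + s2.
Proof.
  induction 1 as [x|n k x y z s HE Hc IH]; intros h Hh; [left; lra|].
  destruct (Rle_lt_dec ((1/2) ^ k) h) as [Hk|Hk].
  - destruct (IH (h - (1/2) ^ k)) as [Hs|H]; [lra|left; lra|right].
    destruct H as (n1 & n2 & k' & u & v & s1 & s2 & H1 & H2 & H3 & H4 & H5 & H6 & H7 & H8).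
    exists (S n1), n2, k', u, v, ((1/2) ^ k + s1), s2.
    repeat split; auto; try lia; try lra. econstructor; eauto.
  - right. exists 0%nat, n, k, x, y, 0, s.
    repeat split; auto; try lia; try lra. constructor.
Qed.

Context (Erefl : forall k x, E k x x).
Context (Esym : forall k x y, E k x y -> E k y x).
Context (E0 : forall x y, E 0 x y).
Context (Ecomp : forall k x y z w, E (S k) x y -> E (S k) y z -> E (S k) z w -> E k x w).

(** Reflexive edges pad the threefold composition law, which lowers the level by one. *)
Lemma E_mono j k x y : (j <= k)%nat -> E k x y -> E j x y.
Proof. induction 1; eauto. Qed.

(* The edge at which the running cost exceeds half of the total cuts the chain into three
   pieces, each related at level [j + 1]. *)
Lemma chain_small n : forall x y s j, chain E n x y s -> s < (1/2) ^ j -> E j x y.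
Proof.
  induction n as [n IH] using (well_founded_induction lt_wf); intros x y s j Hc Hs.
  pose proof (chain_ge0 _ _ _ _ Hc) as H0.
  destruct (chain_split _ _ _ _ Hc (s / 2)) as [H|H]; [lra| |].
  (* Here the total is zero, which forces the empty chain since every edge has positive cost. *)
  - inversion Hc as [|m k ? z ? s' HE Hc']; subst; auto.
    pose proof (half_pow_pos k). pose proof (chain_ge0 _ _ _ _ Hc'). lra.
  - destruct H as (n1 & n2 & k & u & v & s1 & s2 & H1 & H2 & H3 & H4 & H5 & H6 & H7 & H8).
    pose proof (chain_ge0 _ _ _ _ H1). pose proof (chain_ge0 _ _ _ _ H3).
    assert (Hj : (1/2) ^ S j = (1/2) ^ j / 2) by (simpl; field).
    apply Ecomp with u v.
    + apply IH with n1 s1; auto; lra.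
    + apply E_mono with k; auto. apply half_pow_lt_inv. lra.
    + apply IH with n2 s2; auto; lra.
Qed.

(** The metric [D] is the infimum of the costs of chains, and chains exist because [E 0] is total.
    An edge gives [D <= (1/2) ^ k]; conversely [chain_small] turns [D < (1/2) ^ k] into an edge, so
    entourages and balls refine each other. *)
Lemma metrizable_of_entourages (opn : (T -> Prop) -> Prop) :
  (forall x y, (forall k, E k x y) -> x = y) ->
  (forall W, opn W <-> forall p, W p -> exists k, forall y, E k p y -> W y) ->
  metrizable opn.
Proof.
  intros Esep Hopn.
  assert (Hinf : forall x y, exists m, (forall s, (exists n, chain E n x y s) -> m <= s) /\
    forall e, 0 < e -> exists s, (exists n, chain E n x y s) /\ s < m + e).
  { intros x y. apply inf_exists.
    - exists ((1/2) ^ 0), 1%nat. apply chain_one, E0.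
    - intros s [n Hn]. eapply chain_ge0; eauto. }
  pose (D x y := proj1_sig (constructive_indefinite_description _ (Hinf x y))).
  assert (Dle : forall x y n s, chain E n x y s -> D x y <= s).
  { intros x y n s Hc. unfold D. destruct constructive_indefinite_description as [m [H1 H2]].
    simpl. eauto. }
  assert (Dap : forall x y e, 0 < e -> exists s n, chain E n x y s /\ s < D x y + e).
  { intros x y e He. unfold D. destruct constructive_indefinite_description as [m [H1 H2]].
    simpl. destruct (H2 e He) as [s [[n Hn] Hs]]. eauto. }
  assert (Dpos : forall x y, 0 <= D x y).
  { intros x y. apply Rnot_lt_le. intros H.
    destruct (Dap x y (- D x y)) as [s [n [Hc Hs]]]; [lra|].
    apply chain_ge0 in Hc. lra. }
  assert (DE : forall k x y, D x y < (1/2) ^ k -> E k x y).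
  { intros k x y H. destruct (Dap x y ((1/2) ^ k - D x y)) as [s [n [Hc Hs]]]; [lra|].
    apply (chain_small n x y s); auto; lra. }
  assert (Dsym : forall x y, D x y <= D y x).
  { intros x y. apply Rnot_lt_le. intros H.
    destruct (Dap y x (D x y - D y x)) as [s [n [Hc Hs]]]; [lra|].
    destruct (chain_rev Esym _ _ _ _ Hc) as [m Hm]. apply Dle in Hm. lra. }
  exists D. split; [repeat split|].
  - auto.
  - intros H. apply Esep. intros k. apply DE. rewrite H. apply half_pow_pos.
  - intros ->. apply Rle_antisym; auto. apply (Dle y y 0%nat). constructor.
  - intros. apply Rle_antisym; auto.
  - intros x y z. apply Rnot_lt_le. intros H.
    destruct (Dap x y ((D x z - D x y - D y z) / 2)) as [s1 [n1 [Hc1 Hs1]]]; [lra|].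
    destruct (Dap y z ((D x z - D x y - D y z) / 2)) as [s2 [n2 [Hc2 Hs2]]]; [lra|].
    destruct (chain_app _ _ _ _ Hc1 _ _ _ Hc2) as [n Hn]. apply Dle in Hn. lra.
  - intros W. rewrite Hopn. split; intros H p Hp; destruct (H p Hp) as [k Hk].
    + exists ((1/2) ^ k). split; auto. apply half_pow_pos.
    + destruct Hk as [He Hk]. destruct (half_pow_arch k He) as [j Hj].
      exists j. intros y Hy. apply Hk.
      apply Rle_lt_trans with ((1/2) ^ j); auto.
      apply (Dle p y 1%nat). now apply chain_one.
Qed.

End ChainMetric.

Lemma frink_metrization {T : Type} (opn : (T -> Prop) -> Prop) (U : T -> nat -> T -> Prop) :
  (forall p n, U p n p) ->
  (forall p m n, (n <= m)%nat -> forall x, U p m x -> U p n x) ->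
  (forall p q, (forall n, U p n q) -> p = q) ->
  (forall p n, exists m, forall q x, U p m x -> U q m x -> forall y, U q m y -> U p n y) ->
  (forall W, opn W <-> forall p, W p -> exists n, forall x, U p n x -> W x) ->
  metrizable opn.
Proof.
  intros Uin Udec Usep Ufr Hopn.
  assert (Ufr' : forall p n, exists m, (n < m)%nat /\
            forall q x, U p m x -> U q m x -> forall y, U q m y -> U p n y).
  { intros p n. destruct (Ufr p n) as [m Hm]. exists (Nat.max m (S n)). split; [lia|].
    intros q x H1 H2 y H3. apply (Hm q x); (eapply Udec; [|eassumption]; lia). }
  pose (f p n := proj1_sig (constructive_indefinite_description _ (Ufr' p n))).
  assert (Hf : forall p n, (n < f p n)%nat /\
     forall q x, U p (f p n) x -> U q (f p n) x -> forall y, U q (f p n) y -> U p n y).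
  { intros p n. exact (proj2_sig (constructive_indefinite_description _ (Ufr' p n))). }
  (* The modulus [f p] depends on the point; iterating it gives each point its own scale of indices,
     on which one level always costs one application of the hypothesis. *)
  pose (ix p := fix ix (k : nat) : nat := match k with O => O | S k => f p (ix k) end).
  assert (ixS : forall p k, ix p (S k) = f p (ix p k)) by reflexivity.
  assert (ixge : forall p k, (k <= ix p k)%nat).
  { intros p k. induction k; [lia|]. rewrite ixS. destruct (Hf p (ix p k)). lia. }
  pose (F k x y := exists q, U q (ix q k) x /\ U q (ix q k) y).
  assert (Frefl : forall k x, F k x x) by (intros k x; exists x; auto).
  assert (Fsym : forall k x y, F k x y -> F k y x) by (intros k x y [q []]; exists q; auto).
  assert (Fcomp : forall k x y z, F (S k) x y -> F (S k) y z -> F k x z).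
  (* Of two sets sharing [y], the one with the smaller index absorbs the other, so it supplies the
     common centre. *)
  { assert (H : forall k x y z p q, U p (ix p (S k)) x -> U p (ix p (S k)) y ->
              U q (ix q (S k)) y -> U q (ix q (S k)) z -> (ix p (S k) <= ix q (S k))%nat ->
              F k x z).
    { intros k x y z p q Hx Hy Hy' Hz Hle. exists p.
      rewrite ixS in Hx, Hy, Hle. destruct (Hf p (ix p k)) as [Hlt HF]. split.
      - eapply Udec; [|exact Hx]; lia.
      - apply (HF q y); auto; eapply Udec; eauto. }
    intros k x y z [p [Hx Hy]] [q [Hy' Hz]].
    destruct (Nat.le_ge_cases (ix p (S k)) (ix q (S k))).
    - apply (H k x y z p q); auto.
    - apply Fsym, (H k z y x q p); auto. }
  assert (FU : forall p n, exists k0, forall k, (k0 <= k)%nat -> forall y, F k p y -> U p n y).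
  { intros p n. destruct (Ufr p n) as [m Hm]. exists m. intros k Hk y [q [H1 H2]].
    pose proof (ixge q k).
    apply (Hm q p); auto; (eapply Udec; [|eassumption]; lia). }
  (* Doubling the level turns the twofold law [Fcomp] into the threefold law. Level 0 is the total
     relation, so the levels are shifted by one. *)
  pose (E k := match k with O => fun _ _ => True | S k => F (2 * k)%nat end).
  apply (metrizable_of_entourages E); unfold E.
  - intros [|k] x; auto.
  - intros [|k] x y; auto.
  - auto.
  - intros [|k] x y z w; auto. intros H1 H2 H3.
    replace (2 * S k)%nat with (S (S (2 * k))) in * by lia.
    apply (Fcomp _ x z); [eapply Fcomp; eauto|].
    apply (Fcomp _ z w); auto.
  - intros x y H. apply Usep. intros n. destruct (FU x n) as [k0 Hk].
    apply (Hk (2 * k0)%nat); [lia|]. apply (H (S k0)).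
  - intros W. rewrite Hopn. split; intros H p Hp; destruct (H p Hp) as [n Hn].
    + destruct (FU p n) as [k0 Hk]. exists (S k0). intros y Hy. apply Hn.
      apply (Hk (2 * k0)%nat); auto; lia.
    + destruct n as [|n]; [exists O; auto|].
      exists (ix p (2 * n)%nat). intros x Hx. apply Hn. exists p; auto.
Qed.

(** * Sublinear functions *)

Section Sublinear.
Context {k : R -> R} (Hk : sublinear_fun k).

Lemma k_ge1 t : 0 <= t -> 1 <= k t.
Proof. apply Hk. Qed.

Lemma k_mono s t : 0 <= s <= t -> k s <= k t.
Proof. apply Hk. Qed.

Lemma k_star_shaped l t : 0 <= l <= 1 -> 0 <= t -> l * k t <= k (l * t).
Proof.
  intros Hl Ht. destruct Hk as (_ & _ & Hc & _).
  specialize (Hc t 0 l Ht (Rle_refl 0) Hl).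
  replace (l * t + (1 - l) * 0) with (l * t) in Hc by ring.
  pose proof (k_ge1 0 (Rle_refl 0)). nra.
Qed.

(** Concavity on the segment from 0 to [s], with [k 0 >= 0], makes the slope [k t / t]
    nonincreasing. *)
Lemma k_ratio r s : 0 < r <= s -> r * k s <= s * k r.
Proof.
  intros [Hr Hs].
  assert (Hl : 0 <= r / s <= 1).
  { split; [apply Rmult_le_pos; [lra|left; apply Rinv_0_lt_compat; lra]|].
    apply Rmult_le_reg_r with s; [lra|]. unfold Rdiv. rewrite Rmult_assoc, Rinv_l; lra. }
  pose proof (k_star_shaped (r / s) s Hl) as H.
  replace (r / s * s) with r in H by (field; lra).
  replace (r * k s) with (s * (r / s * k s)) by (field; lra).
  apply Rmult_le_compat_l; [lra|apply H; lra].
Qed.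

Lemma k_scale l t : 1 <= l -> 0 <= t -> k (l * t) <= l * k t.
Proof.
  intros Hl [Ht|<-].
  - pose proof (k_ratio t (l * t)) as H.
    apply Rmult_le_reg_l with t; auto. nra.
  - rewrite Rmult_0_r. pose proof (k_ge1 0 (Rle_refl 0)). nra.
Qed.

Lemma k_subadd s t : 0 <= s -> 0 <= t -> k (s + t) <= k s + k t.
Proof.
  intros [Hs|<-] [Ht|<-]; rewrite ?Rplus_0_l, ?Rplus_0_r;
    try (pose proof (k_ge1 0 (Rle_refl 0)); lra).
  pose proof (k_ratio s (s + t)) as H1. pose proof (k_ratio t (s + t)) as H2.
  apply Rmult_le_reg_l with (s + t); nra.
Qed.

Lemma k_affine t : 0 <= t -> k t <= (1 + t) * k 1.
Proof.
  intros Ht. pose proof (k_ge1 1 Rle_0_1).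
  apply Rle_trans with (k (1 + t)); [apply k_mono; lra|].
  replace (k (1 + t)) with (k ((1 + t) * 1)) by (f_equal; ring).
  apply k_scale; lra.
Qed.

(** The factor by which [k] can grow when its argument [s] increases by [n * k s]: subadditivity
    leaves [k (n * k s)], and the affine bound controls that by a multiple of [k s]. *)
Definition kC (n : R) : R := 1 + (1 + n) * k 1.

Lemma kC_ge1 n : 0 <= n -> 1 <= kC n.
Proof. unfold kC. pose proof (k_ge1 1 Rle_0_1). nra. Qed.

Lemma k_near n s t : 0 <= n -> 0 <= s -> 0 <= t -> t <= s + n * k s -> k t <= kC n * k s.
Proof.
  intros Hn Hs Ht H. pose proof (k_ge1 s Hs). pose proof (k_ge1 1 Rle_0_1).
  assert (Hnk : 0 <= n * k s) by nra.
  apply Rle_trans with (k (s + n * k s)); [apply k_mono; lra|].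
  pose proof (k_subadd s _ Hs Hnk). pose proof (k_affine _ Hnk).
  assert ((1 + n * k s) * k 1 <= (1 + n) * k 1 * k s) by nra.
  unfold kC. lra.
Qed.

Lemma k_small c : exists T, 0 < T /\ forall t, T <= t -> c * k t <= t.
Proof.
  destruct Hk as (_ & _ & _ & Hs).
  assert (H1 : 0 < / (Rabs c + 1)).
  { apply Rinv_0_lt_compat. pose proof (Rabs_pos c). lra. }
  destruct (Hs _ H1) as [T HT]. exists (Rmax T 1). split.
  - pose proof (Rmax_r T 1). lra.
  - intros t Ht. pose proof (Rmax_r T 1). pose proof (Rmax_l T 1).
    assert (H2 : k t / t <= / (Rabs c + 1)) by (apply HT; lra).
    pose proof (Rabs_pos c). pose proof (Rle_abs c). pose proof (k_ge1 t).
    assert (Hfin : (Rabs c + 1) * k t <= t).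
    { replace t with ((Rabs c + 1) * t * / (Rabs c + 1)) at 2 by (field; lra).
      replace (k t) with (t * (k t / t)) by (field; lra).
      rewrite Rmult_assoc. apply Rmult_le_compat_l; [lra|].
      apply Rmult_le_compat_l; lra. }
    nra.
Qed.

End Sublinear.

(** * Proper metric spaces *)

(** An intermediate value theorem that yields the first time: the supremum of the times up to which
    [f] stays below [r]. *)
Lemma first_reach (f : R -> R) r T :
  (forall t, 0 <= t -> forall eps, 0 < eps -> exists del, 0 < del /\
     forall s, 0 <= s -> Rabs (s - t) < del -> Rabs (f s - f t) < eps) ->
  f 0 <= r -> 0 <= T -> r <= f T ->
  exists t, 0 <= t <= T /\ f t = r /\ forall s, 0 <= s < t -> f s < r.
Proof.
  intros Hc [H0|H0] HT HfT.
  2:{ exists 0. split; [lra|]. split; auto. intros; lra. }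
  destruct (completeness (fun t => 0 <= t <= T /\ forall s, 0 <= s <= t -> f s < r))
    as [u [Hub Hlub]].
  - exists T. intros t [Ht _]. lra.
  - exists 0. split; [lra|]. intros s Hs. replace s with 0 by lra. auto.
  - assert (Hu0 : 0 <= u).
    { apply Hub. split; [lra|]. intros s Hs. replace s with 0 by lra. auto. }
    assert (HuT : u <= T) by (apply Hlub; intros t [Ht _]; lra).
    assert (Hlt : forall s, 0 <= s < u -> f s < r).
    { intros s Hs. apply NNPP. intros Hn. assert (u <= s); [|lra].
      apply Hlub. intros t [Ht Ht']. apply Rnot_lt_le. intros Hst.
      apply Hn, Ht'. lra. }
    exists u. split; [lra|]. split; auto.
    destruct (Rtotal_order (f u) r) as [Hl|[He|Hg]]; auto; exfalso.
    + destruct (Hc u Hu0 (r - f u)) as [del [Hdel Hc']]; [lra|].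
      destruct (Rle_lt_dec T u) as [|HuT']; [replace u with T in * by lra; lra|].
      set (v := Rmin T (u + del / 2)).
      assert (Hv : u < v <= T).
      { unfold v. split; [apply Rmin_glb_lt; lra|apply Rmin_l]. }
      assert (Hv' : v <= u + del / 2) by apply Rmin_r.
      assert (v <= u); [|lra]. apply Hub. split; [lra|].
      intros s Hs. destruct (Rlt_le_dec s u) as [|Hus]; [apply Hlt; lra|].
      assert (H : Rabs (f s - f u) < r - f u).
      { apply Hc'; [lra|]. rewrite Rabs_right; lra. }
      apply Rabs_def2 in H. lra.
    + destruct (Hc u Hu0 (f u - r)) as [del [Hdel Hc']]; [lra|].
      destruct (Req_dec u 0) as [->|Hu]; [lra|].
      set (v := Rmax 0 (u - del / 2)).
      assert (Hv : 0 <= v < u).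
      { unfold v. split; [apply Rmax_l|apply Rmax_lub_lt; lra]. }
      assert (Hv' : u - del / 2 <= v) by apply Rmax_r.
      assert (H : Rabs (f v - f u) < f u - r).
      { apply Hc'; [lra|]. rewrite Rabs_left; lra. }
      apply Rabs_def2 in H. pose proof (Hlt v Hv). lra.
Qed.

Lemma inv_INR_lt e : 0 < e -> exists N, forall n, (N <= n)%nat -> / (INR n + 1) < e.
Proof.
  intros He. destruct (INR_unbounded (/ e)) as [N HN]. exists N. intros n Hn.
  apply le_INR in Hn. assert (0 < / e) by now apply Rinv_0_lt_compat.
  rewrite <- (Rinv_inv e). apply Rinv_0_lt_contravar; lra.
Qed.

Section Metric.
Context {X : Type} {d : X -> X -> R} (Hd : is_metric d).

Lemma d_ge0 x y : 0 <= d x y.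
Proof. apply Hd. Qed.

Lemma d_refl x : d x x = 0.
Proof. now apply Hd. Qed.

Lemma d_sym x y : d x y = d y x.
Proof. apply Hd. Qed.

Lemma d_tri x y z : d x z <= d x y + d y z.
Proof. apply Hd. Qed.

Lemma d_eq0 x y : d x y <= 0 -> x = y.
Proof. intros H. apply Hd. apply Rle_antisym; auto. apply d_ge0. Qed.

Context (Hprop : proper_space d).

Lemma cluster_point (u : nat -> X) x r : (forall n, d x (u n) <= r) ->
  exists y, forall e, 0 < e -> forall N, exists n, (N <= n)%nat /\ d (u n) y < e.
Proof.
  intros Hu. apply NNPP. intros Hn.
  (* An index is a ball together with a stage after which the sequence avoids it; indices violating
     this give the empty set. A finite subcover would leave no place for a late term. *)
  pose (U (i : X * R * nat) y := 0 < snd (fst i) /\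
          (forall n, (snd i <= n)%nat -> snd (fst i) <= d (u n) (fst (fst i))) /\
          d (fst (fst i)) y < snd (fst i)).
  destruct (Hprop x r _ U) as [l Hl].
  - intros [[z e] N] y [He [HN Hy]]; simpl in *. exists (e - d z y). split; [lra|].
    intros w Hw. repeat split; auto; simpl. pose proof (d_tri z y w). lra.
  - intros y _. apply not_ex_all_not with (n := y) in Hn.
    apply not_all_ex_not in Hn. destruct Hn as [e Hn].
    apply imply_to_and in Hn. destruct Hn as [He Hn].
    apply not_all_ex_not in Hn. destruct Hn as [N Hn].
    exists (y, e, N). repeat split; simpl; auto.
    + intros n Hle. apply Rnot_lt_le. intros H. apply Hn. eauto.
    + now rewrite d_refl.
  - assert (HN : exists N, forall i, In i l -> (snd i <= N)%nat).
    { clear. induction l as [|i l [N HN]]; [exists O; intros ? []|].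
      exists (Nat.max N (snd i)). intros j [->|Hj]; [lia|]. specialize (HN j Hj). lia. }
    destruct HN as [N HN]. destruct (Hl (u N) (Hu N)) as [i [Hi [He [Hi' Hy]]]].
    specialize (Hi' N (HN i Hi)). rewrite d_sym in Hy. lra.
Qed.

Lemma cauchy_limit (u : nat -> X) :
  (forall e, 0 < e -> exists N, forall n m, (N <= n)%nat -> (N <= m)%nat -> d (u n) (u m) < e) ->
  exists x, forall e, 0 < e -> exists N, forall n, (N <= n)%nat -> d (u n) x < e.
Proof.
  intros Hc. destruct (Hc 1 Rlt_0_1) as [N0 HN0].
  destruct (cluster_point (fun n => u (N0 + n)%nat) (u N0) 1) as [x Hx].
  - intros n. left. apply HN0; lia.
  - exists x. intros e He. destruct (Hc (e / 2)) as [N HN]; [lra|].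
    exists N. intros n Hn. destruct (Hx (e / 2)) with (N := N) as [m [Hm Hmx]]; [lra|].
    pose proof (d_tri (u n) (u (N0 + m)%nat) x).
    assert (d (u n) (u (N0 + m)%nat) < e / 2) by (apply HN; lia). lra.
Qed.

Lemma nearest_exists (Z : X -> Prop) z0 x : mclosed d Z -> Z z0 -> exists p, nearest d Z x p.
Proof.
  intros HZ Hz0.
  destruct (inf_exists (fun s => exists z, Z z /\ d x z = s)) as [m [Hm Hap]].
  { exists (d x z0); eauto. }
  { intros s [z [_ <-]]. apply d_ge0. }
  assert (Hpos : forall n, 0 < / (INR n + 1)).
  { intros n. apply Rinv_0_lt_compat. pose proof (pos_INR n). lra. }
  assert (Hu : forall n, exists z, Z z /\ d x z < m + / (INR n + 1)).
  { intros n. destruct (Hap (/ (INR n + 1))) as [s [[z [Hz <-]] Hs]]; eauto. }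
  apply choice in Hu. destruct Hu as [u Hu].
  destruct (cluster_point u x (m + 1)) as [p Hp].
  { intros n. destruct (Hu n) as [_ H]. assert (/ (INR n + 1) <= 1); [|lra].
    rewrite <- Rinv_1 at 2. apply Rinv_le_contravar; [lra|]. pose proof (pos_INR n). lra. }
  (* The minimising sequence only clusters at [p], while closedness asks for a convergent sequence
     in [Z]. *)
  assert (Hv : forall n, exists z, Z z /\ d z p < / (INR n + 1)).
  { intros n. destruct (Hp _ (Hpos n) O) as [j [_ Hj]]. exists (u j). split; auto. apply Hu. }
  apply choice in Hv. destruct Hv as [v Hv].
  exists p. split.
  - apply (HZ v); [apply Hv|]. intros e He. destruct (inv_INR_lt e He) as [N HN].
    exists N. intros n Hn. destruct (Hv n) as [_ H]. specialize (HN n Hn). lra.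
  - intros z' Hz'. apply Rnot_lt_le. intros Hlt.
    assert (H0 : m <= d x z') by (apply Hm; eauto).
    destruct (inv_INR_lt ((d x p - d x z') / 2)) as [N HN]; [lra|].
    destruct (Hp ((d x p - d x z') / 2)) with (N := N) as [n [Hn Hnp]]; [lra|].
    specialize (HN n Hn). destruct (Hu n) as [_ H]. pose proof (d_tri x (u n) p). lra.
Qed.

Context {o : X}.

(** The lower quasi-isometry inequality bounds the parameters of a convergent sequence of points, so
    a limit parameter exists and continuity applies. *)
Lemma qg_closed q Q a : qg_ray d o q Q a -> mclosed d (img a).
Proof.
  intros (Hq & HQ & H0 & Hc & Hqg) u x Hu Hux.
  apply choice in Hu. destruct Hu as [t Ht].
  destruct (Hux 1 Rlt_0_1) as [N0 HN0].
  assert (Hb : forall n, 0 <= t (N0 + n)%nat <= q * (d o x + 1 + Q)).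
  { intros n. destruct (Ht (N0 + n)%nat) as [H1 H2]. split; auto.
    destruct (Hqg (t (N0 + n)%nat) 0) as [H3 _]; auto; [lra|].
    rewrite H0, <- H2, Rminus_0_r, Rabs_right in H3 by lra.
    assert (H4 : d (u (N0 + n)%nat) x < 1) by (apply HN0; lia).
    pose proof (d_tri (u (N0 + n)%nat) x o) as H5. rewrite (d_sym x o) in H5.
    replace (t (N0 + n)%nat) with (q * (t (N0 + n)%nat / q)) by (field; lra).
    apply Rmult_le_compat_l; lra. }
  destruct (Bolzano_Weierstrass (fun n => t (N0 + n)%nat)
    (fun s => 0 <= s <= q * (d o x + 1 + Q)) (compact_P3 _ _) Hb) as [l Hl].
  assert (Hap : forall e, 0 < e -> forall N, exists n, (N <= n)%nat /\
            Rabs (t (N0 + n)%nat - l) < e).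
  { intros e He N.
    destruct (Hl (fun s => Rabs (s - l) < e) N) as [p [Hp Hp']]; eauto.
    exists (mkposreal e He). intros s Hs. exact Hs. }
  assert (Hl0 : 0 <= l).
  { apply Rnot_lt_le. intros Hneg. destruct (Hap (- l)) with (N := O) as [n [_ Hn]]; [lra|].
    destruct (Hb n). apply Rabs_def2 in Hn. lra. }
  exists l. split; auto. apply d_eq0. apply Rnot_lt_le. intros Hlt.
  destruct (Hc l Hl0 (d x (a l) / 2)) as [del [Hdel Hcl]]; [lra|].
  destruct (Hux (d x (a l) / 2)) as [N HN]; [lra|].
  destruct (Hap del Hdel N) as [n [Hn Hnl]].
  destruct (Ht (N0 + n)%nat) as [H1 H2].
  assert (H3 : d (u (N0 + n)%nat) x < d x (a l) / 2) by (apply HN; lia).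
  specialize (Hcl _ H1 Hnl). rewrite <- H2 in Hcl.
  pose proof (d_tri x (u (N0 + n)%nat) (a l)) as H4.
  rewrite (d_sym x (u (N0 + n)%nat)) in H4. lra.
Qed.

End Metric.

(** * Fellow travelling and contraction *)

Section Fellow.
Context {X : Type} {d : X -> X -> R} {o : X} {k : R -> R}.
Context (Hd : is_metric d) (Hk : sublinear_fun k).

(* [Nk] is stated with an infimum; [near] asks for a witness, at the cost of one unit in the
   constant because [1 <= k]. *)
Definition near (Z : X -> Prop) (n : R) (x : X) : Prop :=
  exists z, Z z /\ d x z <= n * k (d o x).

Lemma kx_ge1 x : 1 <= k (d o x).
Proof. apply (k_ge1 Hk), (d_ge0 Hd). Qed.

Lemma near_mono Z n n' x : n <= n' -> near Z n x -> near Z n' x.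
Proof. intros Hn [z [Hz H]]. exists z. split; auto. pose proof (kx_ge1 x). nra. Qed.

Lemma near_of_Nk Z n x : Nk d o k Z n x -> near Z (n + 1) x.
Proof.
  intros H. pose proof (kx_ge1 x). destruct (H (k (d o x))) as [z [Hz Hxz]]; [lra|].
  exists z. split; auto. lra.
Qed.

Lemma Nk_of_near Z n x : near Z n x -> Nk d o k Z n x.
Proof. intros [z [Hz H]] e He. exists z. split; auto. lra. Qed.

Lemma kx_near n x y : 0 <= n -> d x y <= n * k (d o x) -> k (d o y) <= kC (k:=k) n * k (d o x).
Proof.
  intros Hn H. apply (k_near Hk); auto; try apply (d_ge0 Hd).
  pose proof (d_tri Hd o x y). lra.
Qed.

Lemma kx_double x y : d o y <= 2 * d o x -> k (d o y) <= 2 * k (d o x).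
Proof.
  intros H. pose proof (d_ge0 Hd o y). pose proof (d_ge0 Hd o x).
  apply Rle_trans with (k (2 * d o x)); [apply (k_mono Hk)|apply (k_scale Hk)]; lra.
Qed.

Lemma near_trans Z Z' n m x : 0 <= n -> 0 <= m -> (forall z, Z z -> near Z' m z) ->
  near Z n x -> near Z' (n + m * kC (k:=k) n) x.
Proof.
  intros Hn Hm H [z [Hz Hxz]]. destruct (H z Hz) as [z' [Hz' Hzz']].
  exists z'. split; auto. pose proof (d_tri Hd x z z'). pose proof (kx_near n x z Hn Hxz).
  assert (m * k (d o z) <= m * (kC (k:=k) n * k (d o x))) by (apply Rmult_le_compat_l; auto).
  lra.
Qed.

Lemma fellow_near a b : fellow d o k a b <->
  exists n, 0 <= n /\ (forall x, img a x -> near (img b) n x) /\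
            (forall x, img b x -> near (img a) n x).
Proof.
  split.
  - intros [[n Hn] [m Hm]]. pose proof (Rabs_pos n). pose proof (Rabs_pos m).
    pose proof (Rle_abs n). pose proof (Rle_abs m).
    exists (Rabs n + Rabs m + 1). split; [lra|].
    split; intros x Hx; eapply near_mono; try (apply near_of_Nk; eauto); lra.
  - intros [n [Hn [H1 H2]]]. split; exists n; intros x Hx; apply Nk_of_near; auto.
Qed.

Lemma fellow_refl a : fellow d o k a a.
Proof.
  apply fellow_near. exists 0. split; [lra|].
  split; intros x Hx; exists x; split; auto; rewrite (d_refl Hd); lra.
Qed.

Lemma fellow_sym a b : fellow d o k a b -> fellow d o k b a.
Proof. intros [H1 H2]; split; auto. Qed.

Lemma fellow_trans a b c : fellow d o k a b -> fellow d o k b c -> fellow d o k a c.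
Proof.
  rewrite !fellow_near. intros [n [Hn [H1 H2]]] [m [Hm [H3 H4]]].
  pose proof (kC_ge1 Hk n Hn). pose proof (kC_ge1 Hk m Hm).
  exists (n + m * kC (k:=k) n + (m + n * kC (k:=k) m)). split; [nra|].
  split; intros x Hx.
  - apply near_mono with (n + m * kC (k:=k) n); [nra|].
    apply near_trans with (img b); auto.
  - apply near_mono with (m + n * kC (k:=k) m); [nra|].
    apply near_trans with (img b); auto.
Qed.

Context (Hprop : proper_space d) (Hgeo : geodesic_space d).

Lemma point_between x y s : 0 <= s <= d x y -> exists w, d x w = s /\ d w y = d x y - s.
Proof.
  intros Hs. destruct (Hgeo x y) as [c (H0 & H1 & Hc)]. exists (c s).
  assert (E1 : d x (c s) = Rabs (0 - s)) by (rewrite <- H0 at 1; apply Hc; lra).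
  assert (E2 : d (c s) y = Rabs (s - d x y)) by (rewrite <- H1 at 1; apply Hc; lra).
  rewrite E1, E2. split; rewrite Rabs_left1; lra.
Qed.

Definition contracting_with (Z : X -> Prop) (c : R) : Prop :=
  forall x y : X, (forall z, Z z -> d x y <= d x z) ->
    forall p p', (nearest d Z x p \/ nearest d Z y p) ->
                 (nearest d Z x p' \/ nearest d Z y p') ->
                 d p p' <= c * k (d o x).

Lemma contracting_constant Z : contracting d o k Z -> mclosed d Z /\
  exists c, 1 <= c /\ contracting_with Z c.
Proof.
  intros [HZ [c Hc]]. split; auto. exists (Rabs c + 1).
  pose proof (Rabs_pos c). split; [lra|].
  intros x y Hxy p p' H1 H2. pose proof (Hc x y Hxy p p' H1 H2).
  pose proof (kx_ge1 x). pose proof (Rle_abs c). nra.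
Qed.

Lemma nearest_norm Z x p : Z o -> nearest d Z x p -> d x p <= d o x /\ d o p <= 2 * d o x.
Proof.
  intros HZo [_ Hn]. specialize (Hn o HZo). rewrite (d_sym Hd x o) in Hn.
  pose proof (d_tri Hd o x p). lra.
Qed.

(** * Transfer of contraction between fellow-travelling sets *)

Section Transfer.
Context {Z Z' : X -> Prop} {c n : R}.
Context (HZ : mclosed d Z).
Context (HZo : Z o).
Context (HZo' : Z' o).
Context (Hc : 1 <= c).
Context (HcZ : contracting_with Z c).
Context (Hn : 0 <= n).
Context (HZZ' : forall z, Z z -> near Z' n z).
Context (HZ'Z : forall z, Z' z -> near Z n z).

Lemma nearest_dist_le x p p' : nearest d Z x p -> nearest d Z' x p' ->
  d x p' <= d x p + 2 * n * k (d o x).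
Proof.
  intros Hp Hp'. destruct (nearest_norm _ _ _ HZo Hp) as [_ H].
  destruct (HZZ' p (proj1 Hp)) as [z' [Hz' Hpz']].
  pose proof (kx_double _ _ H). pose proof (d_tri Hd x p z').
  pose proof (proj2 Hp' z' Hz'). nra.
Qed.

(* Moving from [x] towards [p'] stays within [d x Z] up to sublinear error, so the
   contraction of [Z] controls the projection along the way. *)
Lemma nearest_close x p p' : nearest d Z x p -> nearest d Z' x p' ->
  d p p' <= (c + 6 * n) * k (d o x).
Proof.
  intros Hp Hp'. pose proof (nearest_dist_le _ _ _ Hp Hp') as HD.
  destruct (nearest_norm _ _ _ HZo' Hp') as [_ H'].
  destruct (HZ'Z p' (proj1 Hp')) as [z [Hz Hp'z]].
  pose proof (kx_double _ _ H') as Hk2. pose proof (kx_ge1 x) as Hk1.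
  assert (Hm0 : 0 <= Rmin (d x p) (d x p') <= d x p').
  { split; [apply Rmin_glb; apply (d_ge0 Hd)|apply Rmin_r]. }
  destruct (point_between x p' _ Hm0) as [w [Hw1 Hw2]].
  destruct (nearest_exists Hd Hprop Z o w HZ HZo) as [s Hs].
  assert (H1 : d p s <= c * k (d o x)).
  { apply (HcZ x w); auto. intros y Hy. rewrite Hw1.
    apply Rle_trans with (d x p); [apply Rmin_l|apply Hp; auto]. }
  assert (H2 : d w p' <= 2 * n * k (d o x)).
  { rewrite Hw2. unfold Rmin. destruct Rle_dec; nra. }
  assert (H3 : n * k (d o p') <= n * (2 * k (d o x))) by (apply Rmult_le_compat_l; auto).
  (* In units of [k (d o x)]: [d p' w <= 2 n] and [d w s <= d w z <= 4 n], whence [6 n]. *)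
  pose proof (proj2 Hs z Hz). pose proof (d_tri Hd w p' z).
  pose proof (d_tri Hd p' w s). rewrite (d_sym Hd p' w) in *.
  pose proof (d_tri Hd p s p'). rewrite (d_sym Hd s p') in *. nra.
Qed.

(** If [y'] is at least [e] away from [Z], contraction applies; otherwise both projections are
    within [2 e] of [y]. *)
Lemma nearest_move y y' p p' e : d y' y <= e -> nearest d Z y p -> nearest d Z y' p' ->
  d p p' <= c * k (d o y') + 4 * e.
Proof.
  intros He Hp Hp'. pose proof (d_ge0 Hd y' y). pose proof (kx_ge1 y').
  destruct (Rle_lt_dec e (d y' p')) as [Hle|Hlt].
  - assert (d p p' <= c * k (d o y')); [|lra].
    apply (HcZ y' y); auto. intros z Hz. pose proof (proj2 Hp' z Hz). lra.
  - pose proof (proj2 Hp p' (proj1 Hp')). pose proof (d_tri Hd y y' p').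
    rewrite (d_sym Hd y y') in *. pose proof (d_tri Hd p y p'). rewrite (d_sym Hd p y) in *.
    pose proof (d_tri Hd y y' p'). nra.
Qed.

(** Compare with projections to [Z]. The constant is [(c + 6 n) + (3 c + 8 n) + 2 (c + 6 n)], for
    the steps from [p'] to [p], to [r], to [r']; the factor 2 accounts for measuring at [x] instead
    of [y]. *)
Lemma contracting_with_transfer : contracting_with Z' (6 * c + 26 * n).
Proof.
  intros x y Hxy.
  destruct (nearest_exists Hd Hprop Z o x HZ HZo) as [p Hp].
  destruct (nearest_exists Hd Hprop Z o y HZ HZo) as [r Hr].
  pose proof (kx_ge1 x) as Hk1.
  assert (Hyn : d o y <= 2 * d o x).
  { pose proof (Hxy o HZo'). rewrite (d_sym Hd x o) in *. pose proof (d_tri Hd o x y). lra. }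
  pose proof (kx_double _ _ Hyn) as Hky.
  assert (Hxx : forall p', nearest d Z' x p' -> d p p' <= (c + 6 * n) * k (d o x)).
  { intros p' Hp'. apply nearest_close; auto. }
  assert (Hyy : forall r', nearest d Z' y r' -> d r r' <= (c + 6 * n) * (2 * k (d o x))).
  { intros r' Hr'. eapply Rle_trans; [eapply nearest_close; eauto|].
    apply Rmult_le_compat_l; lra. }
  assert (Hpr : forall p', nearest d Z' x p' -> d p r <= (3 * c + 8 * n) * k (d o x)).
  { intros p' Hp'. pose proof (nearest_dist_le _ _ _ Hp Hp') as HD.
    pose proof (Hxy p' (proj1 Hp')) as Hyp.
    assert (Hm0 : 0 <= Rmin (d x p) (d x y) <= d x y).
    { split; [apply Rmin_glb; apply (d_ge0 Hd)|apply Rmin_r]. }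
    destruct (point_between x y _ Hm0) as [w [Hw1 Hw2]].
    destruct (nearest_exists Hd Hprop Z o w HZ HZo) as [s Hs].
    assert (Hwp : d x w <= d x p) by (rewrite Hw1; apply Rmin_l).
    assert (H1 : d p s <= c * k (d o x)).
    { apply (HcZ x w); auto. intros z Hz. pose proof (proj2 Hp z Hz). lra. }
    assert (H2 : d w y <= 2 * n * k (d o x)).
    { rewrite Hw2. unfold Rmin. destruct Rle_dec; nra. }
    pose proof (nearest_move y w r s _ H2 Hr Hs) as H3.
    assert (Hkw : k (d o w) <= 2 * k (d o x)).
    { apply kx_double. destruct (nearest_norm _ _ _ HZo Hp). pose proof (d_tri Hd o x w). lra. }
    assert (c * k (d o w) <= c * (2 * k (d o x))) by (apply Rmult_le_compat_l; lra).
    pose proof (d_tri Hd p s r). rewrite (d_sym Hd s r) in *. lra. }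
  assert (Hmix : forall p' r', nearest d Z' x p' -> nearest d Z' y r' ->
            d p' r' <= (6 * c + 26 * n) * k (d o x)).
  { intros p' r' Hp' Hr'. pose proof (Hpr p' Hp'). pose proof (Hxx p' Hp').
    pose proof (Hyy r' Hr'). pose proof (d_tri Hd p' p r').
    pose proof (d_tri Hd p r r'). rewrite (d_sym Hd p' p) in *. lra. }
  intros p' r' [Hp'|Hp'] [Hr'|Hr'].
  - pose proof (Hxx _ Hp'). pose proof (Hxx _ Hr'). pose proof (d_tri Hd p' p r').
    rewrite (d_sym Hd p' p) in *. nra.
  - auto.
  - rewrite (d_sym Hd). auto.
  - pose proof (Hyy _ Hp'). pose proof (Hyy _ Hr'). pose proof (d_tri Hd p' r r').
    rewrite (d_sym Hd p' r) in *. nra.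
Qed.

End Transfer.

Lemma img_start q Q a : qg_ray d o q Q a -> img a o.
Proof. intros (_ & _ & H0 & _). exists 0. split; [lra|auto]. Qed.

(** This puts a glued ray into a class when only its quasi-geodesic constants and its fellow
    travelling are known. *)
Lemma kray_transfer q Q a b : kray d o k a -> qg_ray d o q Q b -> fellow d o k a b ->
  kray d o k b.
Proof.
  intros [[q0 [Q0 Ha]] Hca] Hb Hf. split; eauto.
  destruct (contracting_constant _ Hca) as [HZ [c [Hc HcZ]]].
  apply fellow_near in Hf. destruct Hf as [n [Hn [H1 H2]]].
  split; [eapply (qg_closed Hd); eauto|].
  exists (6 * c + 26 * n). apply (contracting_with_transfer HZ); eauto using img_start.
Qed.

Lemma bdry_eq (A B : bdry d o k) a b : proj1_sig A a -> proj1_sig B b -> fellow d o k a b ->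
  A = B.
Proof.
  destruct A as [A HA], B as [B HB]; simpl. intros Ha Hb Hab.
  assert (A = B) as <-.
  { pose proof HA as [a0 [Ha0 HA']]. pose proof HB as [b0 [Hb0 HB']].
    apply HA' in Ha as [_ Ha]. apply HB' in Hb as [_ Hb].
    apply functional_extensionality. intros e. apply propositional_extensionality.
    rewrite HA', HB'. split; intros [He Hf]; split; auto.
    - eauto using fellow_trans, fellow_sym.
    - eauto using fellow_trans, fellow_sym. }
  f_equal. apply proof_irrelevance.
Qed.

Lemma bdry_fellow (A : bdry d o k) a b : proj1_sig A a -> proj1_sig A b -> fellow d o k a b.
Proof.
  destruct A as [A [a0 [Ha0 HA]]]; simpl. rewrite !HA.
  intros [_ Ha] [_ Hb]. eauto using fellow_trans, fellow_sym.
Qed.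

Lemma bdry_mem (A : bdry d o k) a q Q b : proj1_sig A a -> qg_ray d o q Q b ->
  fellow d o k a b -> proj1_sig A b.
Proof.
  destruct A as [A [a0 [Ha0 HA]]]; simpl. rewrite !HA.
  intros [Ha Hf] Hb Hab. split; [eapply kray_transfer; eauto|].
  eauto using fellow_trans, fellow_sym.
Qed.

End Fellow.

(** * Geodesics near contracting rays *)

(** The error is measured at the larger argument [t]. For large [t] sublinearity gives [t <= 2 * s];
    below the threshold [T] the value [k T] is a bound. *)
Lemma k_absorb k (Hk : sublinear_fun k) M : 0 <= M -> exists C, 1 <= C /\
  forall s t, 0 <= s -> 0 <= t -> t <= s + M * k t -> k t <= C * k s.
Proof.
  intros HM. destruct (k_small Hk (2 * M)) as [T [HT HMT]].
  pose proof (k_ge1 Hk T (Rlt_le _ _ HT)) as HkT.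
  exists (2 + k T). split; [lra|]. intros s t Hs Ht Hst.
  pose proof (k_ge1 Hk s Hs). destruct (Rle_lt_dec T t) as [Hle|Hlt].
  - specialize (HMT t Hle). assert (k t <= k (2 * s)) by (apply (k_mono Hk); lra).
    pose proof (k_scale Hk 2 s). nra.
  - assert (k t <= k T) by (apply (k_mono Hk); lra). nra.
Qed.

(** [P] need not be closed, so its last time is replaced by a point of [P] just before the supremum
    and a point just after it, at most 1 apart. *)
Lemma last_before (P : R -> Prop) a s : P a -> a <= s -> ~ P s ->
  exists u v, a <= u <= v /\ v <= s /\ v <= u + 1 /\ P u /\ forall w, v <= w <= s -> ~ P w.
Proof.
  intros Ha Has Hs.
  destruct (completeness (fun x => a <= x <= s /\ P x)) as [m [Hub Hlub]].
  - exists s. intros x [Hx _]. lra.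
  - exists a. split; auto; lra.
  - assert (Hu : exists u, (a <= u <= s /\ P u) /\ m - 1/2 < u).
    { apply NNPP. intros Hn. assert (m <= m - 1/2); [|lra]. apply Hlub.
      intros x Hx. apply Rnot_lt_le. intros H. apply Hn; eauto. }
    destruct Hu as [u [[Hu HPu] Hmu]].
    assert (Hum : u <= m) by (apply Hub; auto).
    exists u, (Rmin s (m + 1/2)). pose proof (Rmin_l s (m + 1/2)).
    pose proof (Rmin_r s (m + 1/2)).
    assert (u <= Rmin s (m + 1/2)) by (apply Rmin_glb; lra).
    repeat split; auto; try lra.
    + intros w [Hw1 Hw2] HPw. assert (w <= m) by (apply Hub; split; auto; lra).
      unfold Rmin in Hw1. destruct Rle_dec; [|lra].
      replace w with s in HPw by lra. auto.
Qed.

Lemma first_after (P : R -> Prop) s b : P b -> s <= b -> ~ P s ->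
  exists u v, v <= u <= b /\ s <= v /\ u <= v + 1 /\ P u /\ forall w, s <= w <= v -> ~ P w.
Proof.
  intros Hb Hsb Hs.
  destruct (last_before (fun x => P (- x)) (- b) (- s)) as (u & v & H1 & H2 & H3 & H4 & H5);
    rewrite ?Ropp_involutive; auto; [lra|].
  exists (- u), (- v). repeat split; auto; try lra.
  intros w Hw HP. apply (H5 (- w)); [lra|]. now rewrite Ropp_involutive.
Qed.

Lemma edist_scale l p q : 0 <= l ->
  edist (l * fst p, l * snd p) (l * fst q, l * snd q) = l * edist p q.
Proof.
  intros Hl. unfold edist; simpl fst; simpl snd.
  transitivity (sqrt (l * l * ((fst p - fst q) ^ 2 + (snd p - snd q) ^ 2))).
  - f_equal. ring.
  - rewrite sqrt_mult_alt by nra. now rewrite sqrt_square.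
Qed.

Lemma isosceles T w : 0 <= T -> 0 <= w <= 2 * T ->
  exists p q : R * R, edist (0, 0) p = T /\ edist p q = w /\ edist q (0, 0) = T.
Proof.
  intros HT Hw. pose (h := sqrt (T ^ 2 - (w / 2) ^ 2)).
  assert (Hh : h ^ 2 = T ^ 2 - (w / 2) ^ 2) by (apply pow2_sqrt; nra).
  exists (h, w / 2), (h, - (w / 2)). unfold edist; simpl fst; simpl snd.
  repeat split; apply Rsqr_inj; try apply sqrt_pos; try lra;
    rewrite Rsqr_sqrt by nra; unfold Rsqr; nra.
Qed.

Section Geodesics.
Context {X : Type} {d : X -> X -> R} {o : X} {k : R -> R}.
Context (Hd : is_metric d) (Hk : sublinear_fun k) (Hprop : proper_space d) (Hcat : CAT0 d).

Lemma cat_geodesic : geodesic_space d.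
Proof. apply Hcat. Qed.

Definition geod_on (c : R -> X) (L : R) : Prop :=
  c 0 = o /\ forall s t, 0 <= s <= L -> 0 <= t <= L -> d (c s) (c t) = Rabs (s - t).

Lemma geod_on_norm c L s : geod_on c L -> 0 <= s <= L -> d o (c s) = s.
Proof.
  intros [H0 H] Hs. rewrite <- H0 at 1. rewrite H by lra. rewrite Rabs_left1; lra.
Qed.

Lemma geod_on_le c L L' : L' <= L -> geod_on c L -> geod_on c L'.
Proof. intros HL [H0 H]. split; auto. intros; apply H; lra. Qed.

Lemma geod_ray_on c L : geod_ray d o c -> geod_on c L.
Proof. intros [H0 H]. split; auto. intros; apply H; lra. Qed.

Lemma geod_to x : exists c, geod_on c (d o x) /\ c (d o x) = x.
Proof. destruct (cat_geodesic o x) as [c (H0 & H1 & H)]. exists c. repeat split; auto. Qed.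

(** Comparison in the triangle [o], [c1 T], [c2 T]: the comparison points at distance [t] from the
    apex are the base vertices scaled by [t / T]. The third side has to end at [o], hence the
    reversal of [c2]. *)
Lemma geod_on_convex c1 c2 T t : 0 < T -> geod_on c1 T -> geod_on c2 T -> 0 <= t <= T ->
  d (c1 t) (c2 t) <= t / T * d (c1 T) (c2 T).
Proof.
  intros HT G1 G2 Ht. pose proof (proj2 Hcat) as Hc.
  assert (N1 : d o (c1 T) = T) by (apply (geod_on_norm c1 T); auto; lra).
  assert (N2 : d o (c2 T) = T) by (apply (geod_on_norm c2 T); auto; lra).
  assert (N2' : d (c2 T) o = T) by (rewrite (d_sym Hd); auto).
  destruct (cat_geodesic (c1 T) (c2 T)) as [c Hyz].
  destruct (isosceles T (d (c1 T) (c2 T))) as (p & q & E1 & E2 & E3); [lra| |].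
  { split; [apply (d_ge0 Hd)|]. pose proof (d_tri Hd (c1 T) o (c2 T)).
    rewrite (d_sym Hd (c1 T) o) in *. lra. }
  specialize (Hc o (c1 T) (c2 T) c1 c (fun s => c2 (T - s)) (0, 0) p q).
  rewrite N1, N2', E1, E2, E3 in Hc.
  assert (S1 : geodesic_segment d o (c1 T) c1).
  { destruct G1 as [H0 H]. unfold geodesic_segment. rewrite N1. auto. }
  assert (G3 : geodesic_segment d (c2 T) o (fun s => c2 (T - s))).
  { destruct G2 as [H0 H]. unfold geodesic_segment. rewrite N2'.
    split; [f_equal; lra|]. split; [rewrite <- H0; f_equal; lra|].
    intros s u Hs Hu. rewrite H by lra. rewrite <- Rabs_Ropp. f_equal. lra. }
  specialize (Hc S1 Hyz G3 eq_refl eq_refl eq_refl 0%nat 2%nat t (T - t)). simpl in Hc.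
  replace (T - (T - t)) with t in Hc by ring.
  eapply Rle_trans; [apply Hc; lra|]. right.
  rewrite <- E2, <- edist_scale.
  - unfold eseg; simpl fst; simpl snd. f_equal; f_equal; field; lra.
  - apply Rmult_le_pos; [lra|left; now apply Rinv_0_lt_compat].
Qed.

(** * Geodesic segments from the base point to a contracting set *)

Section NearSegment.
Context {Z : X -> Prop} {c : R}.
Context (HZ : mclosed d Z).
Context (HZo : Z o).
Context (Hc : 1 <= c).
Context (HcZ : contracting_with (o:=o) (k:=k) (d:=d) Z c).

(* One step of length [d (g v1) Z] along [g] moves the projection by at most [c * k v1],
   which is at most half the step as long as [g] stays [2 c k]-far from [Z]. *)
Lemma projection_progress g L v2 : geod_on g L -> v2 <= L ->
  forall (n : nat) v1 p1 p2, 0 <= v1 <= v2 -> v2 - v1 <= INR n ->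
  (forall w, v1 <= w <= v2 -> ~ near (o:=o) (k:=k) (d:=d) Z (2 * c) (g w)) ->
  nearest d Z (g v1) p1 -> nearest d Z (g v2) p2 ->
  d p1 p2 <= (v2 - v1) / 2 + c * k v2.
Proof.
  intros Hg HL. assert (N : forall s, 0 <= s <= v2 -> d o (g s) = s).
  { intros s Hs. apply (geod_on_norm g L); auto; lra. }
  induction n as [|n IH]; intros v1 p1 p2 Hv Hn Hfar Hp1 Hp2.
  - simpl in Hn. replace v1 with v2 in * by lra.
    assert (d p1 p2 <= c * k (d o (g v2))); [|rewrite N in *; lra].
    apply (HcZ (g v2) (g v2)); auto. intros z _. rewrite (d_refl Hd). apply (d_ge0 Hd).
  - rewrite S_INR in Hn. pose proof (k_ge1 Hk v1). pose proof (k_mono Hk v1 v2 Hv).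
    assert (Hmove : forall v p, v1 <= v <= v2 -> v - v1 <= d (g v1) p1 ->
              nearest d Z (g v) p -> d p1 p <= c * k v1).
    { intros v p Hv' Hvd Hp. rewrite <- (N v1) by lra. apply (HcZ (g v1) (g v)); auto.
      intros z Hz. rewrite (proj2 Hg) by lra. pose proof (proj2 Hp1 z Hz).
      rewrite Rabs_left1; lra. }
    destruct (Rle_lt_dec (v2 - v1) (d (g v1) p1)) as [Hle|Hlt].
    + pose proof (Hmove v2 p2 ltac:(lra) Hle Hp2). nra.
    + assert (Hbig : 2 * c * k v1 < d (g v1) p1).
      { apply Rnot_le_lt. intros Hn1. apply (Hfar v1); [lra|].
        exists p1. split; [apply Hp1|]. rewrite N; lra. }
      set (v' := v1 + d (g v1) p1) in *.
      destruct (nearest_exists Hd Hprop Z o (g v') HZ HZo) as [p' Hp'].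
      assert (H1 : d p1 p' <= c * k v1) by (apply (Hmove v' p'); unfold v'; auto; nra).
      assert (H2 : d p' p2 <= (v2 - v') / 2 + c * k v2).
      { apply IH; auto; unfold v'; try nra. intros w Hw. apply Hfar. nra. }
      pose proof (d_tri Hd p1 p' p2). unfold v' in *. lra.
Qed.

(** Consider an excursion of [g] outside the [2 c]-neighbourhood. Its projection advances by only
    half its length plus an error, while its ends are near [Z], so the excursion is sublinearly
    short. *)
Lemma segment_near : exists C, 0 <= C /\ forall g L, 0 <= L -> geod_on g L -> Z (g L) ->
  forall s, 0 <= s <= L -> near (o:=o) (k:=k) (d:=d) Z C (g s).
Proof.
  (* [M / 2] collects the distances of the two ends of the excursion from [Z] and the error [c] of
     the projection; the factor 2 clears the half length. *)
  pose (K := 2 * c). pose (M := 2 * (K + 1 + c + 1 + K * kC (k:=k) 1)).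
  pose proof (kC_ge1 Hk 1 Rle_0_1) as HkC.
  assert (HM : 0 <= M) by (unfold M, K; nra).
  destruct (k_absorb k Hk M HM) as [C0 [HC0 Habs]].
  exists (M * C0 + K + 1). split; [unfold K; nra|].
  intros g L HL Hg HgL s Hs.
  assert (N : forall t, 0 <= t <= L -> d o (g t) = t) by (intros; eapply geod_on_norm; eauto).
  destruct (classic (near (o:=o) (k:=k) (d:=d) Z K (g s))) as [Hnear|Hfar].
  { apply (near_mono Hd Hk Z K); auto. nra. }
  assert (Hend : forall t, 0 <= t <= L -> Z (g t) -> near (o:=o) (k:=k) (d:=d) Z K (g t)).
  { intros t Ht HZt. exists (g t). split; auto. rewrite (d_refl Hd).
    pose proof (kx_ge1 (o:=o) Hd Hk (g t)). unfold K. nra. }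
  destruct (last_before (fun t => near (o:=o) (k:=k) (d:=d) Z K (g t)) 0 s)
    as (u1 & v1 & Hu1 & Hv1 & Huv1 & Hn1 & Hf1); auto; [|lra|].
  { apply Hend; [lra|]. rewrite (proj1 Hg). auto. }
  destruct (first_after (fun t => near (o:=o) (k:=k) (d:=d) Z K (g t)) s L)
    as (u2 & v2 & Hu2 & Hv2 & Huv2 & Hn2 & Hf2); auto; [|lra|].
  { apply Hend; auto. lra. }
  assert (Hproj : forall u v, 0 <= u <= L -> 0 <= v <= L -> Rabs (v - u) <= 1 ->
            near (o:=o) (k:=k) (d:=d) Z K (g u) ->
            forall p, nearest d Z (g v) p -> d (g v) p <= K * k u + 1).
  { intros u v Hu Hv Huv [z [Hz Hzu]] p Hp. rewrite N in Hzu by auto.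
    pose proof (proj2 Hp z Hz). pose proof (d_tri Hd (g v) (g u) z).
    rewrite (proj2 Hg) in * by auto. lra. }
  destruct (nearest_exists Hd Hprop Z o (g v1) HZ HZo) as [p1 Hp1].
  destruct (nearest_exists Hd Hprop Z o (g v2) HZ HZo) as [p2 Hp2].
  assert (H1 : d (g v1) p1 <= K * k u1 + 1).
  { apply (Hproj u1 v1); auto; try lra. rewrite Rabs_right; lra. }
  assert (H2 : d (g v2) p2 <= K * k u2 + 1).
  { apply (Hproj u2 v2); auto; try lra. rewrite Rabs_left1; lra. }
  destruct (INR_unbounded (v2 - v1)) as [n Hnn].
  assert (H3 : d p1 p2 <= (v2 - v1) / 2 + c * k v2).
  { apply (projection_progress g L v2 Hg) with (n := n); auto; try lra.
    intros w Hw. destruct (Rle_lt_dec w s); [apply Hf1; lra|apply Hf2; lra]. }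
  assert (Hk1 : k u1 <= k v1) by (apply (k_mono Hk); lra).
  pose proof (k_ge1 Hk v1) as Hkv1. pose proof (k_ge1 Hk v2) as Hkv2.
  assert (Hk12 : k v1 <= k v2) by (apply (k_mono Hk); lra).
  assert (Hk2 : k u2 <= kC (k:=k) 1 * k v2).
  { apply (k_near Hk); lra. }
  assert (Hv12 : v2 - v1 <= M * k v2).
  { pose proof (d_tri Hd (g v1) p1 (g v2)) as H4. pose proof (d_tri Hd p1 p2 (g v2)) as H5.
    rewrite (d_sym Hd p2 (g v2)) in H5. rewrite (proj2 Hg) in H4 by lra.
    rewrite Rabs_left1 in H4 by lra.
    assert (K * k u2 <= K * (kC (k:=k) 1 * k v2)) by (apply Rmult_le_compat_l; unfold K; lra).
    assert (K * k u1 <= K * k v2) by (apply Rmult_le_compat_l; unfold K; lra).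
    unfold M. lra. }
  assert (Hkk : k v2 <= C0 * k v1) by (apply Habs; lra).
  assert (Hks : k v1 <= k s) by (apply (k_mono Hk); lra).
  exists p1. split; [apply Hp1|]. rewrite N by auto.
  pose proof (d_tri Hd (g s) (g v1) p1) as H6. rewrite (proj2 Hg) in H6 by lra.
  rewrite Rabs_right in H6 by lra.
  assert (K * k u1 <= K * k s) by (apply Rmult_le_compat_l; unfold K; lra).
  assert (M * k v2 <= M * (C0 * k s)) by (apply Rmult_le_compat_l; nra).
  pose proof (k_ge1 Hk s). lra.
Qed.

End NearSegment.

Lemma qg_norm_cont q Q a : qg_ray d o q Q a ->
  forall t, 0 <= t -> forall eps, 0 < eps -> exists del, 0 < del /\
     forall s, 0 <= s -> Rabs (s - t) < del -> Rabs (d o (a s) - d o (a t)) < eps.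
Proof.
  intros (_ & _ & _ & Hc & _) t Ht eps He. destruct (Hc t Ht eps He) as [del [Hdel H]].
  exists del. split; auto. intros s Hs Hst. specialize (H s Hs Hst).
  pose proof (d_tri Hd o (a s) (a t)). pose proof (d_tri Hd o (a t) (a s)).
  rewrite (d_sym Hd (a t) (a s)) in *. apply Rabs_def1; lra.
Qed.

Lemma qg_hit_before q Q a r T : qg_ray d o q Q a -> 0 <= r -> 0 <= T -> r <= d o (a T) ->
  exists t, t <= T /\ first_hit d o a r t /\ forall s, 0 <= s < t -> d o (a s) < r.
Proof.
  intros Ha Hr HT HrT.
  destruct (first_reach (fun t => d o (a t)) r T) as [t (Ht & Htr & Hlt)]; auto.
  - eapply qg_norm_cont; eauto.
  - destruct Ha as (_ & _ & -> & _). rewrite (d_refl Hd). auto.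
  - exists t. split; [lra|]. split; auto. split; [lra|]. split; auto.
    intros s Hs. specialize (Hlt s Hs). lra.
Qed.

Lemma qg_norm_ge q Q a t : qg_ray d o q Q a -> 0 <= t -> t / q - Q <= d o (a t).
Proof.
  intros (Hq & HQ & H0 & _ & H) Ht. destruct (H 0 t) as [H1 _]; try lra.
  rewrite H0, Rabs_left1 in H1 by lra. now replace (- (0 - t)) with t in H1 by ring.
Qed.

Lemma qg_escapes q Q a r t : qg_ray d o q Q a -> 0 <= r -> q * (r + Q) <= t -> r <= d o (a t).
Proof.
  intros Ha Hr Ht. pose proof Ha as (Hq & HQ & _).
  assert (H : 0 <= t) by nra. pose proof (qg_norm_ge q Q a t Ha H).
  assert (r + Q <= t / q); [|lra].
  apply Rmult_le_reg_l with q; [lra|]. replace (q * (t / q)) with t by (field; lra). auto.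
Qed.

Lemma qg_hit q Q a r : qg_ray d o q Q a -> 0 <= r ->
  exists t, first_hit d o a r t /\ forall s, 0 <= s < t -> d o (a s) < r.
Proof.
  intros Ha Hr. pose proof Ha as (Hq & HQ & _).
  destruct (qg_hit_before q Q a r (q * (r + Q)) Ha Hr) as [t [_ Ht]]; eauto; [nra|].
  eapply qg_escapes; eauto. lra.
Qed.

(** The constant does not depend on [T2], which is what lets the chords converge as [T2] grows. *)
Lemma qg_near_chord q Q a : qg_ray d o q Q a -> contracting d o k (img a) ->
  exists C, 0 <= C /\ forall T1 T2 g, 0 <= T1 <= T2 -> geod_on g (d o (a T2)) ->
    g (d o (a T2)) = a T2 ->
    exists s, 0 <= s <= d o (a T2) /\ d (a T1) (g s) <= C * k (d o (a T1)).
Proof.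
  intros Ha Hca. pose proof Ha as (Hq & HQ & Ha0 & _ & Hqg).
  destruct (contracting_constant Hd Hk _ Hca) as [HZ [c [Hc HcZ]]].
  destruct (segment_near HZ (img_start _ _ _ Ha) Hc HcZ) as [C1 [HC1 Hseg]].
  pose (M := q * (q * (2 * C1 + 1 + Q)) + Q + (C1 + 1)).
  assert (HM : 0 <= M) by (unfold M; nra).
  destruct (k_absorb k Hk M HM) as [C0 [HC0 Habs]].
  exists (M * C0). split; [nra|].
  intros T1 T2 g HT Hg HgL. set (L := d o (a T2)) in *.
  assert (HL : 0 <= L) by apply (d_ge0 Hd).
  assert (N : forall t, 0 <= t <= L -> d o (g t) = t) by (intros; eapply geod_on_norm; eauto).
  assert (Hv : exists v t1 t2, 0 <= v <= L /\ 0 <= t1 <= T1 /\ T1 <= t2 /\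
            d (g v) (a t1) <= (C1 + 1) * k v /\ d (g v) (a t2) <= C1 * k v).
  (* Just past the last point of the chord near [a [0, T1]], the chord is near a later part of the
     ray and still near the earlier part up to 1. This traps [T1] between two close parameters. *)
  { pose (P s := exists t, 0 <= t <= T1 /\ d (g s) (a t) <= C1 * k s).
    assert (P0 : P 0).
    { exists 0. split; [lra|]. rewrite (proj1 Hg), Ha0, (d_refl Hd).
      pose proof (k_ge1 Hk 0). nra. }
    pose proof (k_ge1 Hk L HL) as HkL.
    destruct (classic (P L)) as [[t1 [Ht1 H1]]|HPL].
    - exists L, t1, T2. repeat split; try lra. rewrite HgL, (d_refl Hd). nra.
    - destruct (last_before P 0 L P0 HL HPL)
        as (u & v & Hu & Hv & Huv & [t1 [Ht1 H1]] & Hf).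
      assert (Hv0 : 0 <= v <= L) by lra.
      destruct (Hseg g L HL Hg) with (s := v) as [z [[t2 [Ht2 ->]] H2]]; auto.
      { rewrite HgL. exists T2. split; auto. lra. }
      rewrite N in H2 by auto. pose proof (k_ge1 Hk v (proj1 Hv0)) as Hkv.
      pose proof (k_mono Hk u v ltac:(lra)) as Hkuv.
      exists v, t1, t2. repeat split; try lra.
      + apply Rnot_lt_le. intros Hlt. apply (Hf v); [lra|]. exists t2. split; auto. lra.
      + pose proof (d_tri Hd (g v) (g u) (a t1)) as H3. rewrite (proj2 Hg) in H3 by lra.
        rewrite Rabs_right in H3 by lra. nra. }
  destruct Hv as (v & t1 & t2 & Hv & Ht1 & Ht2 & H1 & H2).
  exists v. split; auto. pose proof (k_ge1 Hk v (proj1 Hv)) as Hkv.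
  assert (H3 : t2 - t1 <= q * ((2 * C1 + 1 + Q) * k v)).
  { destruct (Hqg t1 t2) as [H3 _]; try lra. rewrite Rabs_left1 in H3 by lra.
    pose proof (d_tri Hd (a t1) (g v) (a t2)) as H4. rewrite (d_sym Hd (a t1) (g v)) in H4.
    replace (t2 - t1) with (q * (- (t1 - t2) / q)) by (field; lra).
    apply Rmult_le_compat_l; [lra|]. nra. }
  assert (H4 : d (a T1) (g v) <= M * k v).
  { destruct (Hqg T1 t1) as [_ H4]; try lra. rewrite Rabs_right in H4 by lra.
    pose proof (d_tri Hd (a T1) (a t1) (g v)) as H5. rewrite (d_sym Hd (a t1)) in H5.
    assert (q * (T1 - t1) <= q * (q * ((2 * C1 + 1 + Q) * k v))).
    { apply Rmult_le_compat_l; lra. }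
    unfold M. nra. }
  assert (H5 : k v <= C0 * k (d o (a T1))).
  { apply Habs; try lra; [apply (d_ge0 Hd)|].
    pose proof (d_tri Hd o (a T1) (g v)) as H5. rewrite N in H5 by auto. lra. }
  rewrite Rmult_assoc. apply Rle_trans with (M * k v); auto.
  apply Rmult_le_compat_l; auto.
Qed.

Lemma geod_ray_qg b : geod_ray d o b -> qg_ray d o 1 0 b.
Proof.
  intros [H0 H]. repeat split; auto; try lra.
  - intros t Ht eps He. exists eps. split; auto. intros s Hs Hst. now rewrite H.
  - rewrite H by auto. lra.
  - rewrite H by auto. lra.
Qed.

Lemma geod_ray_norm b t : geod_ray d o b -> 0 <= t -> d o (b t) = t.
Proof. intros Hb Ht. apply (geod_on_norm b t); [now apply geod_ray_on|lra]. Qed.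

(* The geodesics from [o] to [a n] converge: at radius [r = d o (a T)] they all pass within
   [2 C k r] of [a T], and convexity divides this by [r] at bounded radii. *)
Lemma geodesic_in_class a : kray d o k a -> exists b, geod_ray d o b /\ fellow d o k a b.
Proof.
  intros [[q [Q Ha]] Hca].
  destruct (qg_near_chord q Q a Ha Hca) as [C [HC Hch]].
  pose proof Ha as (Hq & HQ & Ha0 & _ & Hqg).
  assert (Hg : forall n : nat, exists c, geod_on c (d o (a (INR n))) /\
            c (d o (a (INR n))) = a (INR n)) by (intros; apply geod_to).
  apply choice in Hg. destruct Hg as [g Hg].
  assert (Hclose : forall T, 0 <= T -> exists N, forall n, (N <= n)%nat ->
            d o (a T) <= d o (a (INR n)) /\
            d (a T) (g n (d o (a T))) <= 2 * C * k (d o (a T))).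
  { intros T HT. destruct (INR_unbounded (T + q * (d o (a T) + Q))) as [N HN].
    exists N. intros n Hn. apply le_INR in Hn. pose proof (d_ge0 Hd o (a T)) as HaT.
    assert (Hge : d o (a T) <= d o (a (INR n))) by (apply (qg_escapes q Q a); auto; nra).
    split; auto. destruct (Hg n) as [Hg1 Hg2].
    destruct (Hch T (INR n) (g n)) as [s [Hs Hd1]]; auto; [nra|].
    pose proof (geod_on_norm _ _ s Hg1 Hs) as Ns.
    pose proof (d_tri Hd o (a T) (g n s)) as H1. pose proof (d_tri Hd o (g n s) (a T)) as H2.
    rewrite (d_sym Hd (g n s) (a T)) in H2.
    pose proof (d_tri Hd (a T) (g n s) (g n (d o (a T)))) as H3.
    rewrite (proj2 Hg1) in H3 by lra.
    (* Since [g n s] has norm [s], sliding along [g n] to the radius of [a T] costs a second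
       [C * k]. *)
    assert (Rabs (s - d o (a T)) <= C * k (d o (a T))) by (apply Rabs_le; lra). lra. }
  assert (Hcauchy : forall t, 0 <= t -> forall e, 0 < e -> exists N, forall n m,
            (N <= n)%nat -> (N <= m)%nat -> d (g n t) (g m t) < e).
  { intros t Ht e He.
    (* Two of the geodesics are at most [4 C k r] apart at radius [r]; the added ones keep the final
       inequality strict. *)
    destruct (k_small Hk ((t + 1) * (4 * C + 1) / e)) as [R1 [HR1 HR]].
    pose (r := Rmax R1 (t + 1)).
    assert (Hr1 : R1 <= r) by apply Rmax_l. assert (Hr2 : t + 1 <= r) by apply Rmax_r.
    destruct (qg_hit q Q a r Ha) as [T [[HT [HaT _]] _]]; [lra|].
    destruct (Hclose T HT) as [N HN]. exists N. intros n m Hn Hm.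
    destruct (HN n Hn) as [Hn1 Hn2]. destruct (HN m Hm) as [Hm1 Hm2].
    rewrite HaT in *. destruct (Hg n) as [Gn _]. destruct (Hg m) as [Gm _].
    apply Rle_lt_trans with (t / r * d (g n r) (g m r)).
    { apply geod_on_convex; try lra; (eapply geod_on_le; [|eassumption]; lra). }
    pose proof (d_tri Hd (g n r) (a T) (g m r)) as H1. rewrite (d_sym Hd (g n r) (a T)) in H1.
    pose proof (k_ge1 Hk r ltac:(lra)) as Hkr.
    specialize (HR r Hr1).
    assert (H2 : (t + 1) * (4 * C + 1) * k r <= r * e).
    { replace ((t + 1) * (4 * C + 1) * k r)
        with ((t + 1) * (4 * C + 1) / e * k r * e) by (field; lra).
      apply Rmult_le_compat_r; lra. }
    apply Rmult_lt_reg_l with r; [lra|].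
    replace (r * (t / r * d (g n r) (g m r))) with (t * d (g n r) (g m r)) by (field; lra).
    apply Rle_lt_trans with (t * (4 * C * k r)); [apply Rmult_le_compat_l; lra|]. nra. }
  assert (Hlim : forall t, exists x, 0 <= t ->
            forall e, 0 < e -> exists N, forall n, (N <= n)%nat -> d (g n t) x < e).
  { intros t. destruct (Rle_lt_dec 0 t) as [Ht|Ht].
    - destruct (cauchy_limit Hd Hprop (fun n => g n t)) as [x Hx]; eauto.
    (* A default value at negative parameters, where nothing is claimed. *)
    - exists o. lra. }
  apply choice in Hlim. destruct Hlim as [b Hb].
  assert (Hlarge : forall r, exists N, forall n, (N <= n)%nat -> r <= d o (a (INR n))).
  { intros r. destruct (INR_unbounded (q * (Rabs r + Q))) as [N HN]. exists N.
    intros n Hn. apply le_INR in Hn. apply Rle_trans with (Rabs r); [apply Rle_abs|].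
    apply (qg_escapes q Q a); auto; [apply Rabs_pos|lra]. }
  assert (Gb : geod_ray d o b).
  { split.
    - symmetry. apply (d_eq0 Hd). apply Rnot_lt_le. intros Hlt.
      destruct (Hb 0 (Rle_refl 0) _ Hlt) as [N HN]. specialize (HN N (le_n N)).
      destruct (Hg N) as [[H0 _] _]. rewrite H0 in HN. lra.
    - intros s t Hs Ht. apply cond_eq. intros e He.
      destruct (Hb s Hs (e / 2)) as [N1 HN1]; [lra|].
      destruct (Hb t Ht (e / 2)) as [N2 HN2]; [lra|].
      destruct (Hlarge (s + t)) as [N3 HN3].
      pose (n := (N1 + N2 + N3)%nat). specialize (HN1 n ltac:(lia)). specialize (HN2 n ltac:(lia)).
      specialize (HN3 n ltac:(lia)).
      destruct (Hg n) as [[_ G] _]. rewrite <- (G s t) by lra.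
      pose proof (d_tri Hd (b s) (g n s) (b t)) as H1. pose proof (d_tri Hd (g n s) (g n t) (b t)).
      pose proof (d_tri Hd (g n s) (b s) (g n t)) as H2. pose proof (d_tri Hd (b s) (b t) (g n t)).
      rewrite (d_sym Hd (b s) (g n s)) in *. rewrite (d_sym Hd (b t) (g n t)) in *.
      apply Rabs_def1; lra. }
  assert (Hab : forall T, 0 <= T -> d (a T) (b (d o (a T))) <= 2 * C * k (d o (a T))).
  { intros T HT. apply Rnot_lt_le. intros Hlt.
    destruct (Hb (d o (a T)) (d_ge0 Hd _ _) _ (Rgt_minus _ _ Hlt)) as [N1 HN1].
    destruct (Hclose T HT) as [N2 HN2]. specialize (HN1 (N1 + N2)%nat ltac:(lia)).
    destruct (HN2 (N1 + N2)%nat) as [_ H2]; [lia|].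
    pose proof (d_tri Hd (a T) (g (N1 + N2)%nat (d o (a T))) (b (d o (a T)))). lra. }
  exists b. split; auto. apply (fellow_near Hd Hk). exists (2 * C). split; [lra|]. split.
  - intros x [T [HT ->]]. exists (b (d o (a T))). split; auto.
    exists (d o (a T)). split; auto. apply (d_ge0 Hd).
  - intros x [t [Ht ->]]. destruct (qg_hit q Q a t Ha Ht) as [T [[HT [HaT _]] _]].
    exists (a T). split; [exists T; auto|]. specialize (Hab T HT).
    rewrite HaT in Hab. rewrite (geod_ray_norm b t Gb Ht), (d_sym Hd). auto.
Qed.

(** The parameter of a point of [b] is its norm, so the witness can slide to the radius of [x] at
    the price of doubling the constant. *)
Lemma near_geod n b x : 0 <= n -> geod_ray d o b -> near (d:=d) (o:=o) (k:=k) (img b) n x ->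
  d x (b (d o x)) <= 2 * n * k (d o x).
Proof.
  intros Hn Hb [z [[t [Ht ->]] Hx]]. pose proof (d_ge0 Hd o x) as H0.
  pose proof (d_tri Hd x (b t) (b (d o x))) as H1. rewrite (proj2 Hb) in H1 by auto.
  pose proof (d_tri Hd o x (b t)) as H2. pose proof (d_tri Hd o (b t) x) as H3.
  rewrite (geod_ray_norm b t Hb Ht) in *. rewrite (d_sym Hd (b t) x) in *.
  assert (Rabs (t - d o x) <= n * k (d o x)) by (apply Rabs_le; lra). lra.
Qed.

(** At radius [r] the rays are [2 n k r] apart; convexity multiplies this by [t / r], and the
    product tends to 0. *)
Lemma geod_ray_unique a b : geod_ray d o a -> geod_ray d o b -> fellow d o k a b ->
  forall t, 0 <= t -> a t = b t.
Proof.
  intros Ha Hb Hab t Ht. apply (fellow_near Hd Hk) in Hab. destruct Hab as [n [Hn [H1 _]]].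
  apply (d_eq0 Hd). apply Rnot_lt_le. intros Hlt. set (e := d (a t) (b t)) in *.
  destruct (k_small Hk ((t + 1) * (2 * n + 1) / e)) as [R1 [HR1 HR]].
  pose (r := Rmax R1 (t + 1)).
  assert (Hr1 : R1 <= r) by apply Rmax_l. assert (Hr2 : t + 1 <= r) by apply Rmax_r.
  assert (H2 : d (a r) (b r) <= 2 * n * k r).
  { rewrite <- (geod_ray_norm a r Ha) at 2 3 by lra. apply near_geod; auto.
    apply H1. exists r. split; auto; lra. }
  pose proof (geod_on_convex a b r t ltac:(lra) (geod_ray_on a r Ha) (geod_ray_on b r Hb)) as H3.
  specialize (H3 ltac:(lra)). fold e in H3. specialize (HR r Hr1).
  pose proof (k_ge1 Hk r ltac:(lra)) as Hkr.
  assert (H4 : (t + 1) * (2 * n + 1) * k r <= r * e).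
  { replace ((t + 1) * (2 * n + 1) * k r)
      with ((t + 1) * (2 * n + 1) / e * k r * e) by (field; lra).
    apply Rmult_le_compat_r; lra. }
  assert (H5 : r * e <= t * (2 * n * k r)).
  { apply Rle_trans with (r * (t / r * d (a r) (b r))); [apply Rmult_le_compat_l; lra|].
    replace (r * (t / r * d (a r) (b r))) with (t * d (a r) (b r)) by (field; lra).
    apply Rmult_le_compat_l; lra. }
  nra.
Qed.

Lemma class_geodesic (A : bdry d o k) : exists b, proj1_sig A b /\ geod_ray d o b.
Proof.
  destruct (proj2_sig A) as [a [Ha HA]].
  destruct (geodesic_in_class a Ha) as [b [Hb Hab]].
  exists b. split; auto. apply (bdry_mem Hd Hk Hprop cat_geodesic A a 1 0); auto.
  - apply HA. split; auto. apply (fellow_refl Hd Hk).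
  - now apply geod_ray_qg.
Qed.

End Geodesics.

(** * Surgery on quasi-geodesic rays *)

Section Surgery.
Context {X : Type} {d : X -> X -> R} {o : X} {k : R -> R}.
Context (Hd : is_metric d) (Hk : sublinear_fun k) (Hprop : proper_space d) (Hcat : CAT0 d).

Lemma qg_mono q Q q' Q' a : q <= q' -> Q <= Q' -> qg_ray d o q Q a -> qg_ray d o q' Q' a.
Proof.
  intros Hq' HQ' (Hq & HQ & H0 & Hc & H).
  split; [lra|]. split; [lra|]. split; auto. split; auto.
  intros s t Hs Ht. destruct (H s t Hs Ht) as [H1 H2]. pose proof (Rabs_pos (s - t)).
  assert (Rabs (s - t) / q' <= Rabs (s - t) / q).
  { apply Rmult_le_compat_l; auto. apply Rinv_le_contravar; lra. }
  split; [lra|]. nra.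
Qed.

Lemma first_hit_unique a r t t' : first_hit d o a r t -> first_hit d o a r t' -> t = t'.
Proof.
  intros (H1 & H2 & H3) (H1' & H2' & H3').
  destruct (Rtotal_order t t') as [H|[H|H]]; auto; exfalso.
  - apply (H3' t); auto.
  - apply (H3 t'); auto.
Qed.

Lemma restr_mono q Q a r r' x : qg_ray d o q Q a -> 0 <= r <= r' ->
  restr d o a r x -> restr d o a r' x.
Proof.
  intros Ha Hr (tr & t & Htr & Ht & ->).
  destruct (qg_hit Hd q Q a r' Ha) as [t' [Ht' _]]; [lra|].
  exists t', t. split; auto. split; auto. split; [lra|].
  destruct (qg_hit_before Hd q Q a r t' Ha) as [t'' (Hle & Ht'' & _)]; try lra.
  - apply Ht'.
  - rewrite (proj1 (proj2 Ht')). lra.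
  - rewrite (first_hit_unique _ _ _ _ Htr Ht'') in Ht. lra.
Qed.

(** The last hypothesis forbids shortcuts across the junction: both legs are controlled by the
    distance of the endpoints. *)
Lemma qg_glue q Q a tau G : qg_ray d o q Q a -> 0 <= tau -> G tau = a tau ->
  (forall s t, tau <= s <= t -> d (G s) (G t) <= t - s) ->
  (forall s t, tau <= s <= t -> t - s <= 5 * d (G s) (G t) + 2) ->
  (forall s t, 0 <= s <= tau -> tau <= t ->
     d (a s) (a tau) + (t - tau) <= 5 * d (a s) (G t) + 2) ->
  qg_ray d o (5 * q) (Q + 2) (fun t => if Rle_dec t tau then a t else G t).
Proof.
  intros (Hq & HQ & H0 & Hc & Hqg) Htau HGt HG1 HG2 HaG.
  set (h := fun t => if Rle_dec t tau then a t else G t).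
  assert (hl : forall t, t <= tau -> h t = a t).
  { intros t Ht. unfold h. destruct Rle_dec; [auto|lra]. }
  assert (hr : forall t, tau <= t -> h t = G t).
  { intros t Ht. unfold h. destruct Rle_dec; auto. replace t with tau by lra. auto. }
  split; [lra|]. split; [lra|]. split; [rewrite hl; auto|]. split.
  - assert (Hlip : forall s t, tau <= s -> tau <= t -> d (G s) (G t) <= Rabs (s - t)).
    { intros s t Hs Ht. destruct (Rle_lt_dec s t).
      - rewrite Rabs_left1 by lra. specialize (HG1 s t). lra.
      - rewrite Rabs_right by lra. rewrite (d_sym Hd). specialize (HG1 t s). lra. }
    (* Clamping at [tau] treats both sides of the junction at once: the modulus of [a] plus a
       Lipschitz term. *)
    assert (Hsplit : forall s t, 0 <= s -> 0 <= t ->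
      d (h s) (h t) <= d (a (Rmin s tau)) (a (Rmin t tau)) + Rabs (s - t)).
    { intros s t Hs Ht. unfold Rmin.
      destruct (Rle_dec s tau) as [Hst|Hst], (Rle_dec t tau) as [Htt|Htt].
      - rewrite !hl by auto. pose proof (Rabs_pos (s - t)). lra.
      - rewrite (hl s), (hr t) by lra. pose proof (d_tri Hd (a s) (a tau) (G t)).
        pose proof (Hlip tau t ltac:(lra) ltac:(lra)) as H1. rewrite HGt in H1.
        rewrite (Rabs_left1 (tau - t)) in H1 by lra.
        rewrite (Rabs_left1 (s - t)) by lra. lra.
      - rewrite (hr s), (hl t) by lra. pose proof (d_tri Hd (G s) (a tau) (a t)).
        pose proof (Hlip s tau ltac:(lra) ltac:(lra)) as H1. rewrite HGt in H1.
        rewrite (Rabs_right (s - tau)) in H1 by lra.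
        rewrite (Rabs_right (s - t)) by lra. lra.
      - rewrite !hr by lra. rewrite (d_refl Hd). pose proof (Hlip s t). lra. }
    assert (Hmin : forall s t, Rabs (Rmin s tau - Rmin t tau) <= Rabs (s - t)).
    { intros s t. pose proof (Rle_abs (s - t)). pose proof (Rle_abs (- (s - t))).
      rewrite Rabs_Ropp in *. apply Rabs_le. unfold Rmin.
      destruct (Rle_dec s tau), (Rle_dec t tau); lra. }
    intros t Ht eps He.
    destruct (Hc (Rmin t tau)) with (eps := eps / 2) as [del [Hdel Hc']]; [|lra|].
    { apply Rmin_glb; lra. }
    exists (Rmin del (eps / 2)). split; [apply Rmin_glb_lt; lra|].
    intros s Hs Hst. pose proof (Rmin_l del (eps / 2)). pose proof (Rmin_r del (eps / 2)).
    pose proof (Hsplit s t Hs Ht). pose proof (Hmin s t).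
    assert (d (a (Rmin s tau)) (a (Rmin t tau)) < eps / 2); [|lra].
    apply Hc'; [apply Rmin_glb; lra|lra].
  - assert (Hw : forall s t, 0 <= s <= t ->
              t - s <= 5 * q * (d (h s) (h t) + (Q + 2)) /\
              d (h s) (h t) <= 5 * q * (t - s) + (Q + 2)).
    { intros s t Hst. destruct (Rle_lt_dec t tau) as [Ht|Ht];
        [|destruct (Rle_lt_dec s tau) as [Hs|Hs]].
      - rewrite !hl by lra. destruct (Hqg s t) as [H1 H2]; try lra.
        rewrite Rabs_left1 in H1, H2 by lra. pose proof (d_ge0 Hd (a s) (a t)). split; [|nra].
        replace (t - s) with (q * (- (s - t) / q)) by (field; lra).
        rewrite (Rmult_comm 5), Rmult_assoc. apply Rmult_le_compat_l; lra.
      - rewrite (hl s), (hr t) by lra. destruct (Hqg s tau) as [H1 H2]; try lra.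
        rewrite Rabs_left1 in H1, H2 by lra. pose proof (d_ge0 Hd (a s) (G t)).
        pose proof (HaG s t ltac:(lra) ltac:(lra)) as H3.
        pose proof (HG1 tau t ltac:(lra)) as H4.
        pose proof (d_tri Hd (a s) (a tau) (G t)) as H5. rewrite <- HGt in H5 at 2.
        split; [|nra].
        assert (tau - s <= q * (d (a s) (a tau) + Q)).
        { replace (tau - s) with (q * (- (s - tau) / q)) by (field; lra).
          apply Rmult_le_compat_l; lra. }
        nra.
      - rewrite !hr by lra. pose proof (HG1 s t ltac:(lra)). pose proof (HG2 s t ltac:(lra)).
        pose proof (d_ge0 Hd (G s) (G t)). split; nra. }
    assert (Hw' : forall s t, 0 <= s -> 0 <= t ->
              Rabs (s - t) <= 5 * q * (d (h s) (h t) + (Q + 2)) /\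
              d (h s) (h t) <= 5 * q * Rabs (s - t) + (Q + 2)).
    { intros s t Hs Ht. destruct (Rle_lt_dec s t).
      - rewrite Rabs_left1 by lra. replace (- (s - t)) with (t - s) by ring. apply Hw. lra.
      - rewrite Rabs_right by lra. rewrite (d_sym Hd). apply Hw. lra. }
    intros s t Hs Ht. destruct (Hw' s t Hs Ht) as [H1 H2]. split; auto.
    assert (Rabs (s - t) / (5 * q) <= d (h s) (h t) + (Q + 2)); [|lra].
    apply Rmult_le_reg_l with (5 * q); [lra|].
    replace (5 * q * (Rabs (s - t) / (5 * q))) with (Rabs (s - t)) by (field; lra). auto.
Qed.

(** Only bounded initial pieces differ, and [k >= 1] makes any constant bound a sublinear one. *)
Lemma eventually_equal_fellow q Q a c T v : qg_ray d o q Q a -> geod_ray d o c ->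
  0 <= T -> 0 <= v -> (forall t, T <= t -> a t = c (v + (t - T))) -> fellow d o k c a.
Proof.
  intros Ha Hc HT Hv Hac. pose proof Ha as (Hq & HQ & Ha0 & _ & Hqg).
  apply (fellow_near Hd Hk). exists (v + (q * T + Q)).
  assert (0 <= q * T) by nra. split; [lra|]. split.
  - intros x [t [Ht ->]]. pose proof (kx_ge1 (o:=o) Hd Hk (c t)) as Hk1.
    destruct (Rle_lt_dec t v).
    + exists o. split; [exists 0; split; [lra|auto]|].
      rewrite (d_sym Hd). rewrite (geod_ray_norm c t Hc Ht) in *. nra.
    + exists (c t). split.
      * exists (T + (t - v)). split; [lra|]. rewrite Hac by lra. f_equal. lra.
      * rewrite (d_refl Hd). nra.
  - intros x [t [Ht ->]]. pose proof (kx_ge1 (o:=o) Hd Hk (a t)).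
    destruct (Rle_lt_dec t T).
    + exists o. split; [exists 0; split; [lra|symmetry; apply Hc]|].
      destruct (Hqg t 0) as [_ H1]; try lra. rewrite Ha0, Rabs_right in H1 by lra. nra.
    + exists (a t). split.
      * exists (v + (t - T)). split; [lra|]. apply Hac. lra.
      * rewrite (d_refl Hd). nra.
Qed.

(* Follow [a] up to [tau], then a geodesic to [c v], then [c]; the pair [(tau, v)] almost
   minimises the distance from [a [0, ts]] to [c [s, oo)]. *)
Lemma surgery q Q a c s ts : qg_ray d o q Q a -> geod_ray d o c -> 4 <= s -> 0 <= ts ->
  (forall t, 0 <= t <= ts -> d o (a t) <= s) -> d (a ts) (c s) <= s / 4 ->
  exists a' tau, qg_ray d o (5 * q) (Q + 2) a' /\ fellow d o k c a' /\ 0 <= tau /\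
    s / 2 <= d o (a tau) /\ forall t, t <= tau -> a' t = a t.
Proof.
  intros Ha Hc Hs Hts Has Hac.
  destruct (inf_exists (fun l => exists t v, 0 <= t <= ts /\ s <= v /\ d (a t) (c v) = l))
    as [m [Hm Hap]].
  { exists (d (a ts) (c s)), ts, s. repeat split; lra. }
  { intros l (t & v & _ & _ & <-). apply (d_ge0 Hd). }
  destruct (Hap 1 Rlt_0_1) as [L [(tau & v & Htau & Hv & HL) HLm]].
  assert (Hmin : forall t w, 0 <= t <= ts -> s <= w -> L - 1 <= d (a t) (c w)).
  { intros t w Ht Hw. assert (m <= d (a t) (c w)) by (apply Hm; eauto). lra. }
  clear m Hm Hap HLm.
  assert (HL0 : 0 <= L) by (rewrite <- HL; apply (d_ge0 Hd)).
  (* [L <= s / 4 + 1] and [c v] has norm at least [s]; [s >= 4] absorbs the 1. *)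
  assert (Hnorm : s / 2 <= d o (a tau)).
  { pose proof (Hmin ts s ltac:(lra) ltac:(lra)). pose proof (d_tri Hd o (a tau) (c v)) as H1.
    rewrite (geod_ray_norm c v Hc) in H1 by lra. lra. }
  destruct (cat_geodesic Hcat (a tau) (c v)) as [e (He0 & He1 & He)].
  rewrite HL in He1, He.
  pose (G t := if Rle_dec t (tau + L) then e (t - tau) else c (v + (t - (tau + L)))).
  assert (Gl : forall t, t <= tau + L -> G t = e (t - tau)).
  { intros t Ht. unfold G. destruct Rle_dec; [auto|lra]. }
  assert (Gr : forall t, tau + L <= t -> G t = c (v + (t - (tau + L)))).
  { intros t Ht. unfold G. destruct Rle_dec; auto. replace t with (tau + L) by lra.
    replace (v + (tau + L - (tau + L))) with v by ring. rewrite <- He1. f_equal. ring. }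
  assert (Hea : forall u, 0 <= u <= L -> d (a tau) (e u) = u).
  { intros u Hu. rewrite <- He0 at 1. rewrite He by lra. rewrite Rabs_left1; lra. }
  assert (Hec : forall u, 0 <= u <= L -> d (e u) (c v) = L - u).
  { intros u Hu. rewrite <- He1 at 1. rewrite He by lra. rewrite Rabs_left1; lra. }
  assert (Hcc : forall u w, 0 <= u <= w -> d (c u) (c w) = w - u).
  { intros u w Hu. rewrite (proj2 Hc) by lra. rewrite Rabs_left1; lra. }
  exists (fun t => if Rle_dec t tau then a t else G t), tau.
  assert (Hqg : qg_ray d o (5 * q) (Q + 2) (fun t => if Rle_dec t tau then a t else G t)).
  { apply qg_glue; auto; try lra.
    - rewrite Gl by lra. rewrite <- He0. f_equal. ring.
    - intros t u Htu. destruct (Rle_lt_dec u (tau + L)) as [Hu|Hu];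
        [|destruct (Rle_lt_dec t (tau + L)) as [Ht|Ht]].
      + rewrite !Gl by lra. rewrite He by lra. rewrite Rabs_left1; lra.
      + rewrite (Gl t), (Gr u) by lra.
        pose proof (d_tri Hd (e (t - tau)) (c v) (c (v + (u - (tau + L))))) as H1.
        rewrite Hec in H1 by lra. rewrite Hcc in H1 by lra. lra.
      + rewrite !Gr by lra. rewrite Hcc by lra. lra.
    - intros t u Htu. destruct (Rle_lt_dec u (tau + L)) as [Hu|Hu];
        [|destruct (Rle_lt_dec t (tau + L)) as [Ht|Ht]].
      + rewrite !Gl by lra. rewrite He by lra. rewrite Rabs_left1; lra.
      + rewrite (Gl t), (Gr u) by lra. remember (v + (u - (tau + L))) as w eqn:Hw.
        pose proof (Hmin tau w Htau ltac:(lra)) as H1.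
        pose proof (d_tri Hd (a tau) (e (t - tau)) (c w)) as H2.
        rewrite Hea in H2 by lra.
        pose proof (d_tri Hd (c v) (e (t - tau)) (c w)) as H3.
        rewrite (d_sym Hd (c v) (e _)), Hec in H3 by lra.
        rewrite Hcc in H3 by lra.
        pose proof (d_ge0 Hd (e (t - tau)) (c w)). lra.
      + rewrite !Gr by lra. rewrite Hcc by lra. lra.
    - intros t u Ht Hu. destruct (Rle_lt_dec u (tau + L)) as [HuL|HuL].
      + rewrite Gl by lra. pose proof (Hmin t v ltac:(lra) Hv) as H1.
        pose proof (d_tri Hd (a t) (e (u - tau)) (c v)) as H2. rewrite Hec in H2 by lra.
        pose proof (d_tri Hd (a t) (e (u - tau)) (a tau)) as H3.
        rewrite (d_sym Hd (e _) (a tau)), Hea in H3 by lra.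
        pose proof (d_ge0 Hd (a t) (e (u - tau))). lra.
      (* This case sets the constants 5 and 2. Writing [D] for [d (a t) (c w)], near-minimality
         gives [L <= D + 1], and [d o (a t) <= s <= v] gives [w - v <= D]; the two legs are at most
         [3 D + 1] and [2 D + 1]. *)
      + rewrite Gr by lra. remember (v + (u - (tau + L))) as w eqn:Hw.
        pose proof (Hmin t w ltac:(lra) ltac:(lra)) as H1.
        pose proof (d_tri Hd o (a t) (c w)) as H2.
        rewrite (geod_ray_norm c w Hc) in H2 by lra.
        pose proof (Has t ltac:(lra)) as H3.
        pose proof (d_tri Hd (a t) (c w) (a tau)) as H4.
        pose proof (d_tri Hd (c w) (c v) (a tau)) as H5.
        rewrite (d_sym Hd (c w) (c v)), Hcc, (d_sym Hd (c v) (a tau)), HL in H5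
          by lra.
        lra. }
  split; auto. split.
  - apply (eventually_equal_fellow (5 * q) (Q + 2) _ c (tau + L) v); auto; try lra.
    intros t Ht. destruct Rle_dec as [Hle|Hgt]; [|apply Gr; auto].
    rewrite <- Gr by auto. rewrite Gl by lra. replace t with tau by lra.
    rewrite <- He0. f_equal. ring.
  - split; [lra|]. split; auto. intros t Ht. destruct Rle_dec; [auto|lra].
Qed.

End Surgery.

(** * The neighbourhoods of boundary points *)

Section Boundary.
Context {X : Type} {d : X -> X -> R} {o : X} {k : R -> R} {M : bdry d o k -> R -> R -> R}.
Context (Hd : is_metric d) (Hprop : proper_space d) (Hcat : CAT0 d) (Hk : sublinear_fun k).
Context (HM : Morse_gauges d o k M).

Lemma gauge_ratio r r' : 0 < r <= r' -> r / (2 * k r) <= r' / (2 * k r').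
Proof.
  intros Hr. pose proof (k_ge1 Hk r). pose proof (k_ge1 Hk r').
  pose proof (k_ratio Hk r r' Hr).
  apply Rmult_le_reg_l with (2 * k r * (2 * k r')); [nra|].
  replace (2 * k r * (2 * k r') * (r / (2 * k r))) with (2 * (r * k r')) by (field; lra).
  replace (2 * k r * (2 * k r') * (r' / (2 * k r'))) with (2 * (r' * k r)) by (field; lra).
  lra.
Qed.

Lemma Uk_antitone B r r' A : 0 < r <= r' -> Uk d o k M B r' A -> Uk d o k M B r A.
Proof.
  intros Hr HU b Hb Hgb q Q a Ha Hqa Hq x Hx. apply (HU b Hb Hgb q Q a Ha Hqa).
  - pose proof (gauge_ratio r r' Hr). lra.
  - eapply (restr_mono Hd); eauto. lra.
Qed.

(** A ray of the class is near [b] with a constant of its own; the Morse property at a far radius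
    improves it to the gauge. *)
Lemma Uk_self B r : 0 < r -> Uk d o k M B r B.
Proof.
  intros Hr b Hb Hgb q Q a Ha Hqa Hq x Hx.
  pose proof (bdry_fellow Hd Hk B a b Ha Hb) as Hf.
  apply (fellow_near Hd Hk) in Hf. destruct Hf as [n [Hn [Hab _]]].
  destruct (proj2 (HM B) b Hb Hgb r (n + 1) Hr ltac:(lra) k Hk) as [R0 [HR0 HR]].
  destruct (qg_hit Hd q Q a R0 Hqa) as [tR [HtR _]]; [lra|].
  apply (HR q Q a Hqa Hq tR HtR); auto.
  destruct (Hab (a tR)) as [z [Hz Hz']]; [exists tR; split; auto; apply HtR|].
  intros e He. exists z. split; auto. rewrite (proj1 (proj2 HtR)) in Hz'.
  pose proof (k_ge1 Hk R0). lra.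
Qed.

Lemma geod_ray_restr a r t : geod_ray d o a -> 0 <= t <= r -> restr d o a r (a t).
Proof.
  intros Ha Ht. exists r, t. repeat split; auto; try lra.
  - rewrite (geod_ray_norm a r Ha); lra.
  - intros s Hs. rewrite (geod_ray_norm a s Ha); lra.
Qed.

(** The factor 16 makes the error [2 (M + 1) k t] of [Uk_near] at most [t / 8]; two such errors fill
    the gap [s / 4] allowed by [surgery]. *)
Lemma radius_exists (B : bdry d o k) (m : nat) : exists r, 0 < r /\ forall t, r <= t ->
  INR m <= t /\ 4 <= t /\ 16 * (M B (INR m) (INR m) + 1) * k t <= t.
Proof.
  destruct (k_small Hk (16 * (M B (INR m) (INR m) + 1))) as [T [HT H]].
  pose proof (pos_INR m). exists (T + INR m + 4). split; [lra|].
  intros t Ht. split; [lra|]. split; [lra|]. apply H. lra.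
Qed.

Definition radius_incr (B : bdry d o k) (m : nat) : R :=
  proj1_sig (constructive_indefinite_description _ (radius_exists B m)).

(** Partial sums increase and dominate every earlier increment, so the conditions for all [j <= m]
    hold together at [radius B m]. *)
Definition radius (B : bdry d o k) : nat -> R := sum_f_R0 (radius_incr B).

Lemma radius_incr_spec B m : 0 < radius_incr B m /\ forall t, radius_incr B m <= t ->
  INR m <= t /\ 4 <= t /\ 16 * (M B (INR m) (INR m) + 1) * k t <= t.
Proof. unfold radius_incr. now destruct constructive_indefinite_description. Qed.

Lemma radius_pos B m : 0 < radius B m.
Proof.
  induction m; unfold radius in *; simpl; [apply radius_incr_spec|].
  pose proof (proj1 (radius_incr_spec B (S m))). lra.
Qed.

Lemma radius_mono B m n : (m <= n)%nat -> radius B m <= radius B n.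
Proof.
  induction 1 as [|n _ IH]; [lra|].
  pose proof (proj1 (radius_incr_spec B (S n))). unfold radius in *; simpl. lra.
Qed.

Lemma radius_spec B j m : (j <= m)%nat ->
  INR j <= radius B m /\ 4 <= radius B m /\
  16 * (M B (INR j) (INR j) + 1) * k (radius B m) <= radius B m.
Proof.
  intros Hj. apply (proj2 (radius_incr_spec B j)).
  apply Rle_trans with (radius B j); [|now apply radius_mono].
  destruct j; [right; reflexivity|].
  pose proof (radius_pos B j). unfold radius in *; simpl. lra.
Qed.

Lemma radius_gauge B j m : (j <= m)%nat ->
  M B (INR j) (INR j) <= radius B m / (2 * k (radius B m)).
Proof.
  intros Hj. destruct (radius_spec B j m Hj) as (_ & H4 & H).
  pose proof (k_ge1 Hk (radius B m)).
  assert (0 <= M B (INR j) (INR j)) by apply (proj1 (HM B)).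
  apply Rmult_le_reg_l with (2 * k (radius B m)); [lra|].
  replace (2 * k (radius B m) * (radius B m / (2 * k (radius B m)))) with (radius B m)
    by (field; lra).
  nra.
Qed.

Lemma Uk_near B m A b a j q Q t : Uk d o k M B (radius B m) A ->
  proj1_sig B b -> geod_ray d o b -> proj1_sig A a -> qg_ray d o q Q a ->
  q <= INR j -> Q <= INR j -> (j <= m)%nat -> restr d o a (radius B m) (a t) ->
  d (a t) (b (d o (a t))) <= 2 * (M B (INR j) (INR j) + 1) * k (d o (a t)).
Proof.
  intros HU Hb Hgb Ha Hqa Hq HQ Hj Ht.
  assert (0 <= M B (INR j) (INR j)) by apply (proj1 (HM B)).
  apply (near_geod Hd); auto; [lra|]. apply (near_of_Nk Hd Hk).
  apply (HU b Hb Hgb (INR j) (INR j) a); auto using radius_gauge.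
  apply (qg_mono q Q); auto.
Qed.

(** The geodesic of [A] is a [(1, 1)]-quasi-geodesic, so a single gauge value bounds its distance to
    [b] at all radii. *)
Lemma Uk_separated B A : (forall n, Uk d o k M B (radius B n) A) -> B = A.
Proof.
  intros HU.
  destruct (class_geodesic Hd Hk Hprop Hcat A) as [a [Ha Hga]].
  destruct (class_geodesic Hd Hk Hprop Hcat B) as [b [Hb Hgb]].
  apply (bdry_eq Hd Hk B A b a); auto.
  assert (Hab : forall t, 0 <= t -> d (a t) (b t) <= 2 * (M B (INR 1) (INR 1) + 1) * k t).
  { intros t Ht. destruct (INR_unbounded t) as [n Hn].
    rewrite <- (geod_ray_norm a t Hga Ht) at 2 3.
    apply (Uk_near B (S n) A b a 1 1 0); auto; simpl; try lra; try lia.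
    - now apply geod_ray_qg.
    - apply geod_ray_restr; auto. split; auto.
      destruct (radius_spec B (S n) (S n) (le_n _)) as [H _]. rewrite S_INR in H. lra. }
  assert (0 <= M B (INR 1) (INR 1)) by apply (proj1 (HM B)).
  apply (fellow_near Hd Hk). exists (2 * (M B (INR 1) (INR 1) + 1)). split; [lra|].
  split; intros x [t [Ht ->]].
  - exists (a t). split; [exists t; auto|].
    rewrite (d_sym Hd), (geod_ray_norm b t Hgb Ht); auto.
  - exists (b t). split; [exists t; auto|]. rewrite (geod_ray_norm a t Hga Ht); auto.
Qed.

(* The Morse property of [b] is only available for rays that come close to [b] at radius [R0].
   A ray of [D] and the geodesic [c] of [C] are both close to [a] at radius [radius A m], so
   surgery turns the ray into a ray of the class [C] without changing it up to radius [R0],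
   and rays of [C] are close to [b]. *)
Lemma Uk_frink B n : exists m, forall A C,
  Uk d o k M B (radius B m) C -> Uk d o k M A (radius A m) C ->
  forall D, Uk d o k M A (radius A m) D -> Uk d o k M B (radius B n) D.
Proof.
  destruct (class_geodesic Hd Hk Hprop Hcat B) as [b [Hb Hgb]].
  set (r := radius B n). assert (Hr : 0 < r) by apply radius_pos.
  (* [N] bounds all constants admissible at radius [r], because the gauge dominates [max(q, Q)];
     [N >= 1] lets [7 N] dominate [5 q] and [Q + 2]. *)
  destruct (INR_unbounded r) as [N0 HN0]. set (N := S N0).
  assert (HN : r <= INR N) by (unfold N; rewrite S_INR; lra).
  assert (HN1 : 1 <= INR N) by (unfold N; rewrite S_INR; pose proof (pos_INR N0); lra).
  set (N' := (7 * N)%nat).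
  assert (HN' : INR N' = 7 * INR N) by (unfold N'; rewrite mult_INR; simpl; lra).
  set (F := M B (INR N') (INR N')).
  assert (HF : 0 <= F) by apply (proj1 (HM B)).
  destruct (proj2 (HM B) b Hb Hgb r (F + 1) Hr ltac:(lra) k Hk) as [R0 [HR0 HMorse]].
  (* Surgery at radius [s >= m] leaves the ray intact only up to some point of norm at least
     [s / 2]. *)
  destruct (INR_unbounded (2 * R0)) as [N1 HN1'].
  set (m := (N' + N1)%nat). exists m. intros A C HBC HAC D HAD.
  assert (HmN : INR N <= INR m) by (apply le_INR; unfold m, N'; lia).
  assert (HmR : 2 * R0 <= INR m).
  { apply Rle_trans with (INR N1); [lra|]. apply le_INR. unfold m. lia. }
  destruct (class_geodesic Hd Hk Hprop Hcat A) as [a [Ha Hga]].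
  destruct (class_geodesic Hd Hk Hprop Hcat C) as [c [Hc Hgc]].
  intros b' Hb' Hgb' q Q eta Heta Hqg Hgauge x Hx.
  assert (HqQ : q <= INR N /\ Q <= INR N).
  { assert (Hmax : Rmax q Q <= r / (2 * k r)).
    { pose proof (proj2 (proj1 (HM B) q Q)). lra. }
    assert (r / (2 * k r) <= r).
    { pose proof (k_ge1 Hk r). apply Rmult_le_reg_l with (2 * k r); [lra|].
      replace (2 * k r * (r / (2 * k r))) with r by (field; lra). nra. }
    pose proof (Rmax_l q Q). pose proof (Rmax_r q Q). lra. }
  destruct HqQ as [HqN HQN].
  set (s := radius A m). destruct (radius_spec A m m (le_n m)) as (Hms & H4s & Hks).
  fold s in Hms, H4s, Hks.
  destruct (qg_hit Hd q Q eta s Hqg) as [ts [Hts Hts']]; [lra|].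
  pose proof Hts as (Hts0 & Htss & _).
  assert (Heta_s : d (eta ts) (a s) <= s / 8).
  { pose proof (Uk_near A m D a eta m q Q ts HAD Ha Hga Heta Hqg) as H.
    rewrite Htss in H. specialize (H ltac:(lra) ltac:(lra) (le_n m)).
    assert (restr d o eta (radius A m) (eta ts))
      by (exists ts, ts; split; [exact Hts|split; [lra|auto]]).
    specialize (H H0). lra. }
  assert (Hc_s : d (c s) (a s) <= s / 8).
  { pose proof (Uk_near A m C a c m 1 0 s HAC Ha Hga Hc (geod_ray_qg _ Hgc)) as H.
    rewrite (geod_ray_norm c s Hgc) in H by lra.
    specialize (H ltac:(lra) ltac:(lra) (le_n m)).
    assert (restr d o c (radius A m) (c s)) by (apply geod_ray_restr; auto; fold s; lra).
    specialize (H H0). lra. }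
  destruct (surgery (k:=k) Hd Hk Hcat q Q eta c s ts Hqg Hgc H4s Hts0)
    as (eta' & tau & Hqg' & Hfel & Htau & Hnorm & Hagree).
  { intros t Ht. destruct (Req_dec t ts) as [->|Hne]; [lra|].
    left. apply Hts'. lra. }
  { pose proof (d_tri Hd (eta ts) (a s) (c s)) as H. rewrite (d_sym Hd (a s) (c s)) in H. lra. }
  assert (Heta' : proj1_sig C eta').
  { eapply (bdry_mem Hd Hk Hprop (cat_geodesic Hcat) C c); eauto. }
  assert (Hqg'' : qg_ray d o (INR N') (INR N') eta') by (eapply qg_mono; [| |eauto]; lra).
  destruct (qg_hit_before Hd q Q eta R0 tau Hqg) as (tR & HtRtau & HtR & _); try lra.
  assert (HtR' : first_hit d o eta' R0 tR).
  { destruct HtR as (H1 & H2 & H3). split; auto. split; [rewrite Hagree; auto|].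
    intros u Hu. rewrite Hagree by lra. auto. }
  assert (HNk : Nk d o k (img b) F (eta' tR)).
  { apply (HBC b Hb Hgb (INR N') (INR N') eta'); auto.
    - apply radius_gauge. unfold m. lia.
    - apply (restr_mono Hd (INR N') (INR N') _ R0); auto.
      + destruct (radius_spec B m m (le_n m)). lra.
      + exists tR, tR. split; [exact HtR'|]. split; [|auto]. destruct HtR. lra. }
  assert (HNkx : Nk d o k (img b) (M B q Q) x).
  { apply (HMorse q Q eta Hqg Hgauge tR HtR); auto.
    intros e He. destruct (HNk e He) as [z [Hz Hz']]. exists z. split; auto.
    rewrite (proj1 (proj2 HtR')), Hagree in Hz' by auto.
    pose proof (k_ge1 Hk R0). lra. }
  (* The neighbourhood speaks of every geodesic ray [b'] of the class, but [R0] was chosen for [b];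
     the two agree at nonnegative parameters. *)
  intros e He. destruct (HNkx e He) as [z [[t [Ht ->]] Hz]].
  exists (b t). split; auto. exists t. split; auto.
  apply (geod_ray_unique (o:=o) (k:=k) Hd Hk Hcat); auto. apply (bdry_fellow Hd Hk B); auto.
Qed.

End Boundary.

Theorem theorem4p8 (X : Type) (d : X -> X -> R) (o : X) (k : R -> R)
  (M : bdry d o k -> R -> R -> R) :
  is_metric d -> proper_space d -> CAT0 d -> sublinear_fun k ->
  Morse_gauges d o k M ->
  metrizable (bd_open d o k M).
Proof.
  intros Hd Hprop Hcat Hk HM.
  apply (frink_metrization _ (fun B n => Uk d o k M B (radius Hk (M:=M) B n))).
  - intros B n. apply Uk_self; auto. apply radius_pos.
  - intros B m n Hmn A. apply Uk_antitone; auto. split; [apply radius_pos|].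
    now apply radius_mono.
  - intros B A. now apply Uk_separated.
  - intros B n. now apply Uk_frink.
  (* The values [radius B n >= n] are cofinal among real radii, so both families define the same
     open sets. *)
  - intros W. split; intros H B HB; destruct (H B HB) as [r Hr].
    + destruct Hr as [Hr HW]. destruct (INR_unbounded r) as [n Hn]. exists n.
      intros A HA. apply HW. apply (Uk_antitone Hd Hk B r (radius Hk (M:=M) B n)); auto.
      destruct (radius_spec Hk (M:=M) B n n (le_n n)) as [H1 _]. split; auto.
      apply Rle_trans with (INR n); [lra|apply H1].
    + exists (radius Hk (M:=M) B r). split; auto. apply radius_pos.
Qed.
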